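(* Let $U\subset\mathbb R^n$ ($n\ge2$) be open, let $\alpha=\sqrt{\alpha_{ij}(x)y^iy^j}$ be a Riemannian metric and $\beta=b_i(x)y^i$ a $1$-form on $U$, and let $F=\alpha\,(s^2-s-1)$, $s=\beta/\alpha$, be the golden $(\alpha,\beta)$-metric. Then $F$ is projectively flat in $U$ if and only if there are a smooth function $\tau=\tau(x)$ and a $1$-form $\theta=\theta_i(x)y^i$ on $U$ such that (i) $b_{i|j}=\tau\big((2b^2-1)\alpha_{ij}-3b_ib_j\big)$, and (ii) $G^i_\alpha=\theta\,y^i-\tau\,\alpha^2b^i$. In this case the spray coefficients of $F$ are $$G^i=(\theta+\tau\,\chi\,\alpha)\,y^i,\qquad \chi:=\frac{(1-2s)(1+s^2)}{2(s^2-s-1)}-s.$$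
   Context: Notation: $(\alpha^{ij})$ is the inverse matrix of $(\alpha_{ij})$, $b^i=\alpha^{ij}b_j$, $b^2=\alpha^{ij}b_ib_j$, $b_{i|j}$ is the covariant derivative of $\beta$ with respect to the Levi-Civita connection of $\alpha$, and $G^i_\alpha$ are the spray coefficients of $\alpha$. The spray coefficients of a Finsler metric $F$ with $g_{ij}=\frac12\frac{\partial^2F^2}{\partial y^i\partial y^j}$ are $G^i=\frac14g^{il}\left(\frac{\partial^2F^2}{\partial x^k\partial y^l}y^k-\frac{\partial F^2}{\partial x^l}\right)$, so geodesics satisfy $\ddot x^i+2G^i(x,\dot x)=0$. The golden $(\alpha,\beta)$-metric is considered as a Finsler metric on the open conic set of $(x,y)$, $y\ne0$, with $s^2-s-1>0$ and $2b^2-3s^2-1>0$, which is assumed to be nonempty over every $x\in U$. A Finsler metric on $U\subset\mathbb R^n$ is projectively flat in $U$ if its geodesics are straight line segments in the coordinates of $U$, equivalently $G^i(x,y)=P(x,y)\,y^i$ for some function $P$ positively homogeneous of degree $1$ in $y$. (On a manifold, projectively flat means that this holds in suitable local coordinates.) *)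

(* Defs.v *)
From mathcomp Require Import all_boot all_order all_algebra.
From mathcomp Require Import all_classical all_reals all_analysis.

Set Implicit Arguments.
Unset Strict Implicit.
Unset Printing Implicit Defensive.

Import Order.TTheory GRing.Theory Num.Theory.
Import numFieldNormedType.Exports.
Local Open Scope classical_set_scope.
Local Open Scope ring_scope.

Section Calculus.
Context {R : realType} {n : nat}.

Definition partial (i : 'I_n) (f : 'rV[R]_n -> R) (x : 'rV[R]_n) : R :=
  'D_(delta_mx 0 i) f x.

Definition iter_partial (l : seq 'I_n) (f : 'rV[R]_n -> R) : 'rV[R]_n -> R :=
  foldr partial f l.

(* C^oo on U, for U open; values of f outside U are irrelevant. *)
Definition smooth_on (U : set 'rV[R]_n) (f : 'rV[R]_n -> R) : Prop :=
  forall (l : seq 'I_n) (x : 'rV[R]_n), U x -> differentiable (iter_partial l f) x.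

(* A 1-form theta_i(x) y^i is given by the row vector of its components. *)
Definition smooth_form (U : set 'rV[R]_n) (b : 'rV[R]_n -> 'rV[R]_n) : Prop :=
  forall i, smooth_on U (fun x => b x 0 i).

Definition one_form (b : 'rV[R]_n -> 'rV[R]_n) (x y : 'rV[R]_n) : R :=
  \sum_i b x 0 i * y 0 i.

End Calculus.

(* A Finsler metric is written as a function F x y of a point x and a tangent
   vector y; D x is the open cone of admissible directions at x. *)
Section Finsler.
Context {R : realType} {n : nat}.
Implicit Types (F : 'rV[R]_n -> 'rV[R]_n -> R) (x y : 'rV[R]_n).

Definition fund_tensor F x y : 'M[R]_n :=
  \matrix_(i, j)
    (2^-1 * partial i (partial j (fun y' => F x y' ^+ 2)) y).

Definition spray F (i : 'I_n) x y : R :=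
  4^-1 * \sum_l invmx (fund_tensor F x y) i l *
    ((\sum_k partial k (fun x' => partial l (fun y' => F x' y' ^+ 2) y) x
               * y 0 k)
     - partial l (fun x' => F x' y ^+ 2) x).

(* The geodesics x'' + 2 G(x, x') = 0 with velocity in D are straight lines:
   G^i = P y^i with P positively homogeneous of degree 1 in y. *)
Definition projectively_flat (U : set 'rV[R]_n) (D : 'rV[R]_n -> set 'rV[R]_n)
    F : Prop :=
  exists P : 'rV[R]_n -> 'rV[R]_n -> R,
    (forall x y (c : R), U x -> D x y -> 0 < c -> P x (c *: y) = c * P x y) /\
    (forall x y i, U x -> D x y -> spray F i x y = P x y * y 0 i).

End Finsler.

Section AlphaBeta.
Context {R : realType} {n : nat}.
Variables (a : 'rV[R]_n -> 'M[R]_n) (b : 'rV[R]_n -> 'rV[R]_n).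
Implicit Types (x y : 'rV[R]_n) (i j k : 'I_n).

Definition riemannian (U : set 'rV[R]_n) : Prop :=
  [/\ forall i j, smooth_on U (fun x => a x i j),
      forall x i j, U x -> a x i j = a x j i &
      forall x y, U x -> y != 0 ->
        0 < \sum_i \sum_j a x i j * y 0 i * y 0 j].

Definition alpha x y : R :=
  Num.sqrt (\sum_i \sum_j a x i j * y 0 i * y 0 j).

Definition christoffel k i j x : R :=
  2^-1 * \sum_l invmx (a x) k l *
    (partial i (fun x' => a x' j l) x + partial j (fun x' => a x' i l) x
     - partial l (fun x' => a x' i j) x).

(* b_{i|j} *)
Definition cov_deriv i j x : R :=
  partial j (fun x' => b x' 0 i) x - \sum_k christoffel k i j x * b x 0 k.

(* b^i *)
Definition b_up i x : R := \sum_j invmx (a x) i j * b x 0 j.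

(* b^2 *)
Definition bnorm2 x : R := \sum_i \sum_j invmx (a x) i j * b x 0 i * b x 0 j.

Definition sratio x y : R := one_form b x y / alpha x y.

Definition golden x y : R :=
  alpha x y * (sratio x y ^+ 2 - sratio x y - 1).

(* With phi = s^2 - s - 1, det g = phi^(n+1) (phi - s phi')^(n-2)
   (2 b^2 - 3 s^2 - 1) det a, where phi - s phi' = - (1 + s^2); so the
   fundamental tensor is invertible on this cone. *)
Definition golden_cone x : set 'rV[R]_n :=
  [set y | [/\ y != 0,
               0 < sratio x y ^+ 2 - sratio x y - 1 &
               0 < 2 * bnorm2 x - 3 * sratio x y ^+ 2 - 1]].

Definition golden_chi x y : R :=
  let s := sratio x y in
  (1 - 2 * s) * (1 + s ^+ 2) / (2 * (s ^+ 2 - s - 1)) - s.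

End AlphaBeta.

(* Main.v *)
(* Write s = beta / alpha. The numerator of the spray of F splits as
     4 F F_{y^l} P + 2 F H_l, with P = F_{x^k} y^k / (2 F) and
     H_l = F_{x^k y^l} y^k - F_{x^l}.
   Since g_{li} y^i = F F_{y^l}, g is invertible on the cone and H_l y^l = 0,
   the metric is projectively flat iff H = 0 on the cone. Multiplied by
   alpha^5 / 2, this reads N_l = alpha^5 S_{l0} / 2 with S_{l0} the curl of beta
   and N_l polynomial in y. As alpha^2 is a positive quadratic polynomial on
   every line missing the origin, squaring and comparing factorizations forces
   S = 0, and then the polynomial identity N = 0 holds for all y. Contracting it
   with b^l shows that r_00 = b_{i|j} y^i y^j vanishes on the null cone of the
   indefinite form Q = (2 b^2 - 1) alpha^2 - 3 beta^2, so r_00 = tau Q; this is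
   (i). Substituting back, G_alpha + tau alpha^2 b is parallel to y for all y,
   and being quadratic it is theta y with theta linear; this is (ii). *)
Require Import Defs.
From mathcomp Require Import all_boot all_order all_algebra.
From mathcomp Require Import all_classical all_reals all_analysis.
From mathcomp Require Import ring lra.

Set Implicit Arguments.
Unset Strict Implicit.
Unset Printing Implicit Defensive.

Import Order.TTheory GRing.Theory Num.Theory.
Import numFieldNormedType.Exports.
Local Open Scope classical_set_scope.
Local Open Scope ring_scope.

(** * Quadratic forms and polynomials along lines *)

Section QuadraticForms.
Context {R : comNzRingType} {n : nat}.
Implicit Types (u v w y : 'rV[R]_n) (N : 'M[R]_n).

(** The equations are given on the golden cone only, but the argument lives outside it: Q is
    positive on the cone, so the null vectors of Q and b^# itself, where Q = - b^2 (b^2 + 1), are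
    not in it. Identities are carried to all vectors along lines: a function that is polynomial on
    every line and vanishes on a short piece of each line through one cone vector is zero. This is
    why denominators are cleared and the spray is kept with its index lowered, as a_{li} G^i, until
    the end. Division by Q is legitimate only on the cone; the spray is therefore solved for there,
    and the resulting polynomial identity is extended once more. The algebra is done at a single x,
    for arbitrary a, b, M and N, and tells nothing about how tau and theta vary with x. Their
    smoothness comes from closed formulas: tau is r_00 / Q at b^#, and theta_p is the p-th component
    of G_alpha + tau alpha^2 b^# at the p-th basis vector. Both are rational in the metric, the form
    and their first derivatives. *)

Definition dot u v : R := \sum_i u 0 i * v 0 i.

Definition quad N y : R := dot (y *m N) y.

Lemma dotC u v : dot u v = dot v u.
Proof. by apply: eq_bigr => i _; rewrite mulrC. Qed.

Lemma dotDl u v w : dot (u + v) w = dot u w + dot v w.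
Proof. by rewrite -big_split; apply: eq_bigr => i _; rewrite mxE mulrDl. Qed.

Lemma dotDr u v w : dot w (u + v) = dot w u + dot w v.
Proof. by rewrite !(dotC w) dotDl. Qed.

Lemma dotZl c u v : dot (c *: u) v = c * dot u v.
Proof. by rewrite [RHS]mulr_sumr; apply: eq_bigr => i _; rewrite mxE mulrA. Qed.

Lemma dotZr c u v : dot u (c *: v) = c * dot u v.
Proof. by rewrite !(dotC u) dotZl. Qed.

Lemma dotNl u v : dot (- u) v = - dot u v.
Proof. by rewrite -scaleN1r dotZl mulN1r. Qed.

Lemma dotNr u v : dot u (- v) = - dot u v.
Proof. by rewrite !(dotC u) dotNl. Qed.

Lemma dot0l v : dot 0 v = 0.
Proof. by rewrite -(scale0r 0) dotZl mul0r. Qed.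

Lemma dot0r v : dot v 0 = 0.
Proof. by rewrite dotC dot0l. Qed.

Definition dotE := (dotDl, dotDr, dotNl, dotNr, dotZl, dotZr).

Lemma dot_mulmx N u v : dot (u *m N) v = dot u (v *m N^T).
Proof.
rewrite /dot; under eq_bigr => i _ do rewrite mxE mulr_suml.
rewrite exchange_big /=; apply: eq_bigr => j _.
rewrite mxE mulr_sumr; apply: eq_bigr => i _.
by rewrite mxE -mulrA (mulrC (N _ _)).
Qed.

Lemma dot_mulmx_sum N u v :
  dot (u *m N) v = \sum_i \sum_j N i j * u 0 i * v 0 j.
Proof.
rewrite exchange_big; apply: eq_bigr => j _; rewrite mxE mulr_suml.
by apply: eq_bigr => i _; rewrite (mulrC (N i j)).
Qed.

Lemma quadE N y : quad N y = \sum_i \sum_j N i j * y 0 i * y 0 j.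
Proof. exact: dot_mulmx_sum. Qed.

Lemma dot_delta u i : dot u (delta_mx 0 i) = u 0 i.
Proof.
rewrite /dot (bigD1 i) //= big1 ?addr0 => [|j ji]; first by rewrite mxE !eqxx mulr1.
by rewrite mxE (negPf ji) andbF mulr0.
Qed.

Lemma quadD N u v :
  quad N (u + v) = quad N u + quad N v + (dot (u *m N) v + dot (v *m N) u).
Proof. by rewrite /quad mulmxDl !dotE; ring. Qed.

Lemma quadZ N c u : quad N (c *: u) = c ^+ 2 * quad N u.
Proof. by rewrite /quad -scalemxAl !dotE; ring. Qed.

Lemma quad0 N : quad N 0 = 0.
Proof. by rewrite /quad dot0r. Qed.

Lemma quad_parallelogram N u v :
  quad N (u + v) + quad N (u - v) = 2 * quad N u + 2 * quad N v.
Proof.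
rewrite -(scaleN1r v) !quadD quadZ -scalemxAl !dotE; ring.
Qed.

Lemma quad_addmx N N' y : quad (N + N') y = quad N y + quad N' y.
Proof. by rewrite /quad mulmxDr dotDl. Qed.

Lemma quad_scalemx c N y : quad (c *: N) y = c * quad N y.
Proof. by rewrite /quad -scalemxAr dotZl. Qed.

End QuadraticForms.

Lemma sym_quad_inj {R : numFieldType} {n : nat} (N N' : 'M[R]_n) :
  N^T = N -> N'^T = N' -> quad N =1 quad N' -> N = N'.
Proof.
move=> sN sN' e; apply/matrixP => i j.
have E (P : 'M[R]_n) : P^T = P -> 2 * P i j =
   quad P (delta_mx 0 i + delta_mx 0 j) - quad P (delta_mx 0 i) - quad P (delta_mx 0 j).
  move=> sP; rewrite quadD dot_mulmx sP (dotC _ (_ *m _)) -!rowE !dot_delta mxE.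
  by rewrite -[in P j i]sP mxE; ring.
by apply: (@mulfI _ 2); rewrite ?pnatr_eq0 // (E N) // (E N') // !e.
Qed.

Section LinePolynomials.
Context {R : numFieldType} {n : nat}.
Implicit Types (f g : 'rV[R]_n -> R).

(** A substitute for polynomials in n variables: it is stable under ring operations, and univariate
    root counting is all that the vanishing arguments need. *)
Definition line_poly f := forall u v, exists p : {poly R},
  forall t, f (u + t *: v) = p.[t].

Lemma line_poly_const c : line_poly (fun=> c).
Proof. by move=> u v; exists c%:P => t; rewrite hornerC. Qed.

Lemma line_poly_add f g :
  line_poly f -> line_poly g -> line_poly (fun y => f y + g y).
Proof.
move=> hf hg u v; have [p pE] := hf u v; have [q qE] := hg u v.
by exists (p + q) => t; rewrite hornerD pE qE.
Qed.

Lemma line_poly_mul f g :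
  line_poly f -> line_poly g -> line_poly (fun y => f y * g y).
Proof.
move=> hf hg u v; have [p pE] := hf u v; have [q qE] := hg u v.
by exists (p * q) => t; rewrite hornerM pE qE.
Qed.

Lemma line_poly_opp f : line_poly f -> line_poly (fun y => - f y).
Proof. by move=> hf u v; have [p pE] := hf u v; exists (- p) => t; rewrite hornerN pE. Qed.

Lemma line_poly_sub f g :
  line_poly f -> line_poly g -> line_poly (fun y => f y - g y).
Proof. by move=> hf hg; apply: line_poly_add => //; apply: line_poly_opp. Qed.

Lemma line_poly_sqr f : line_poly f -> line_poly (fun y => f y ^+ 2).
Proof. by move=> hf; apply: line_poly_mul. Qed.

Lemma line_poly_dot b : line_poly (fun y => dot b y).
Proof.
move=> u v; exists ((dot b u)%:P + dot b v *: 'X) => t.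
by rewrite !dotE !hornerE mulrC.
Qed.

Lemma line_poly_coord (N : 'M[R]_n) l : line_poly (fun y => (y *m N) 0 l).
Proof.
move=> u v; have [p pE] := line_poly_dot (delta_mx 0 l *m N^T) u v.
by exists p => t; rewrite -pE dotC -dot_mulmx dot_delta.
Qed.

Lemma line_poly_quad N : line_poly (quad N).
Proof.
move=> u v; exists (quad N v *: 'X^2 + (dot (u *m N) v + dot (v *m N) u) *: 'X
  + (quad N u)%:P) => t.
by rewrite quadD quadZ -scalemxAl !dotE !hornerE /=; ring.
Qed.

Lemma line_poly_sum m (f : 'I_m -> 'rV[R]_n -> R) :
  (forall i, line_poly (f i)) -> line_poly (fun y => \sum_i f i y).
Proof.
move=> h u v; have [p pE] := fin_all_exists (fun i => h i u v).
by exists (\sum_i p i) => t; rewrite horner_sum; apply: eq_bigr.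
Qed.

Lemma poly_eq0_small (p : {poly R}) (e : R) : 0 < e ->
  (forall t, `|t| < e -> p.[t] = 0) -> p = 0.
Proof.
move=> e0 h; apply/eqP/negP => /negP p0.
(* These are [size p] distinct roots, one more than a nonzero [p] can have; denominators start at 2
   so that every point is strictly below [e]. *)
pose s := [seq e / (k.+2)%:R | k <- iota 0 (size p)].
have us : uniq s.
  rewrite map_inj_uniq ?iota_uniq // => i j /(mulfI (lt0r_neq0 e0)) /invr_inj.
  by move/eqP; rewrite eqr_nat => /eqP [].
have rs : all (root p) s.
  apply/allP => _ /mapP[k _ ->]; apply/rootP/h.
  rewrite ger0_norm ?divr_ge0 ?ler0n ?ltW // ltr_pdivrMr ?ltr0n //.
  by rewrite ltr_pMr // ltr1n.
by have := max_poly_roots p0 rs us; rewrite size_map size_iota ltnn.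
Qed.

(** An arbitrary [y] is the point t = 1 of the line from [y0] in direction [y - y0], so [D] need
    only contain a short segment around [y0] in each direction. *)
Lemma line_poly_eq0 (D : 'rV[R]_n -> Prop) y0 f :
  (forall v, exists2 e : R, 0 < e & forall t, `|t| < e -> D (y0 + t *: v)) ->
  line_poly f -> (forall y, D y -> f y = 0) -> forall y, f y = 0.
Proof.
move=> oD hf f0 y; have [p pE] := hf y0 (y - y0); have [e e0 De] := oD (y - y0).
have p0 : p = 0 by apply: (poly_eq0_small e0) => t te; rewrite -pE f0 //; apply: De.
by have := pE 1; rewrite scale1r addrC subrK p0 horner0.
Qed.

End LinePolynomials.

(* P and M may be taken coprime, so that M is constant, and then P is linear
   and its root is a root of A. *)
Lemma sqr_eq_posdef_mul_sqr (R : realFieldType) (A P M : {poly R}) :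
  size A = 3 -> (forall t, 0 < A.[t]) -> P ^+ 2 = A * M ^+ 2 -> M = 0.
Proof.
move=> sA A0 e; apply/eqP/negP => /negP M0.
have g0 : gcdp P M != 0 by rewrite gcdp_eq0 (negPf M0) andbF.
pose P' := P %/ gcdp P M; pose M' := M %/ gcdp P M.
have PE : P = P' * gcdp P M by rewrite divpK // dvdp_gcdl.
have ME : M = M' * gcdp P M by rewrite divpK // dvdp_gcdr.
have co : coprimep P' M' by apply: coprimep_div_gcd; rewrite M0 orbT.
have e' : P' ^+ 2 = A * M' ^+ 2.
  by apply: (mulIf (expf_neq0 2 g0)); rewrite -[RHS]mulrA -!exprMn -PE -ME.
have : M' %| 1.
  have co2 : coprimep M' (P' ^+ 2) by rewrite coprimep_sym coprimep_expl.
  rewrite -(Gauss_dvdpr _ co2) mulr1 e'.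
  by rewrite expr2 mulrA dvdp_mull.
rewrite dvdp1 => /size_poly1P [c c0 M'E].
have sP : size P' = 2.
  have : size (P' ^+ 2) = 3 by rewrite e' M'E -polyC_exp mulrC mul_polyC size_scale ?expf_neq0.
  move=> s3; have := size_exp P' 2; rewrite s3 /= muln2.
  by case: (size P') => [|[|[|k]]].
have [x Px] : exists x, P'.[x] = 0.
  by have [x /rootP xP] := poly2_root sP; exists x.
have : P'.[x] ^+ 2 = A.[x] * M'.[x] ^+ 2 by rewrite -horner_exp e' hornerM horner_exp.
rewrite M'E hornerC Px expr0n /=.
move/esym/eqP; rewrite mulf_eq0 expf_eq0 (negPf c0) andbF orbF => /eqP Ax.
by have := A0 x; rewrite Ax ltxx.
Qed.

(** * The Hamel equations at a point *)

Lemma unitmx_inj (F : fieldType) (n : nat) (N : 'M[F]_n) :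
  (forall v : 'rV_n, v *m N = 0 -> v = 0) -> N \in unitmx.
Proof.
move=> h; rewrite -row_free_unit -kermx_eq0; apply/eqP/row_matrixP => i.
by rewrite row0; apply: h; rewrite -row_mul mulmx_ker row0.
Qed.

(** Lines serve twice. Those through [y0] carry the squared, hence polynomial, identity from [D] to
    all vectors. Then a line through [y] that misses the origin turns [quad a] into a quadratic
    without real roots, which is not a quotient of two squares. *)
Lemma line_poly_sqrt_eq0 (R : rcfType) (n : nat) (a : 'M[R]_n)
    (D : 'rV[R]_n -> Prop) (y0 : 'rV[R]_n) (P M : 'rV[R]_n -> R) :
  (2 <= n)%N -> (forall y, y != 0 -> 0 < quad a y) ->
  (forall v, exists2 e : R, 0 < e & forall t, `|t| < e -> D (y0 + t *: v)) ->
  line_poly P -> line_poly M ->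
  (forall y, D y -> P y = Num.sqrt (quad a y) * M y) ->
  forall y, y != 0 -> M y = 0.
Proof.
move=> n2 apos oD hP hM PM.
have age0 y : 0 <= quad a y.
  by have [->|/apos/ltW //] := eqVneq y 0; rewrite quad0.
have sq y : P y ^+ 2 - quad a y * M y ^+ 2 = 0.
  apply: (line_poly_eq0 oD (f := fun y => P y ^+ 2 - quad a y * M y ^+ 2)) => [|z Dz].
    apply: line_poly_sub; first exact: line_poly_sqr.
    by apply: line_poly_mul; [exact: line_poly_quad|exact: line_poly_sqr].
  by rewrite PM // exprMn sqr_sqrtr // subrr.
move=> y y_n0.
have [i yi] : exists i, y 0 i != 0.
  apply/existsP; rewrite -negb_forall; apply: contra y_n0 => /forallP h.
  by apply/eqP/rowP => i; rewrite mxE; apply/eqP.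
(* Moving in direction [j] leaves the nonzero coordinate [i] fixed, so the line misses the origin;
   this is where dimension at least 2 enters. *)
have [j ji] : exists j : 'I_n, j != i.
  have [i0|i0] := eqVneq (i : nat) 0; last by exists (Ordinal (ltnW n2)); rewrite -val_eqE /= eq_sym.
  by exists (Ordinal n2); rewrite -val_eqE /= i0.
pose v : 'rV[R]_n := delta_mx 0 j.
have line_n0 t : y + t *: v != 0.
  apply: contra yi => /eqP /rowP /(_ i); rewrite !mxE eqxx /= eq_sym (negPf ji).
  by rewrite mulr0 addr0 => ->.
have v_n0 : v != 0.
  by apply/eqP => /rowP /(_ j); rewrite !mxE !eqxx => /eqP; rewrite oner_eq0.
pose A : {poly R} := Poly [:: quad a y; dot (y *m a) v + dot (v *m a) y; quad a v].
have AE t : A.[t] = quad a (y + t *: v).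
  by rewrite horner_Poly /= quadD quadZ -scalemxAl !dotE; ring.
have sA : size A = 3 by rewrite (@PolyK _ 0) //= gt_eqF ?apos.
have [p pE] := hP y v; have [m mE] := hM y v.
have e : p ^+ 2 = A * m ^+ 2.
  apply/eqP; rewrite -subr_eq0; apply/eqP.
  apply: (@poly_eq0_small _ _ 1) => // t _.
  by rewrite hornerD hornerN horner_exp hornerM horner_exp AE -pE -mE sq.
have A0 t : 0 < A.[t] by rewrite AE apos.
have m0 := sqr_eq_posdef_mul_sqr sA A0 e.
by have := mE 0; rewrite scale0r addr0 m0 horner0.
Qed.

Section PointwiseHamel.
Context {R : rcfType} {n : nat}.
Variables (a : 'M[R]_n) (b : 'rV[R]_n) (M : 'M[R]_n) (N : 'I_n -> 'M[R]_n).
Hypotheses (n2 : (2 <= n)%N) (asym : a^T = a).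
Hypothesis apos : forall y : 'rV[R]_n, y != 0 -> 0 < quad a y.
Implicit Types (y u v w : 'rV[R]_n).

Local Notation A := (quad a).
Local Notation B := (dot b).
Local Notation bu := (b *m invmx a).
Local Notation b2 := (dot bu b).
Local Notation G := (fun y : 'rV[R]_n => \row_l quad (N l) y).

(** This is alpha^5 H_l / 2 at one point, when [M] holds the derivatives of b_l by x^k and [G] is
    the lowered spray of alpha. The square root multiplies only the curl [M - M^T]; everything else
    is polynomial in [y]. *)
Definition hamel_residual y (l : 'I_n) : R :=
  (A y * quad M y - 2 * B y * dot y (G y)) * (A y * b 0 l - B y * (y *m a) 0 l)
  - (A y + B y ^+ 2) * (A y * G y 0 l - dot y (G y) * (y *m a) 0 l)
  + A y ^+ 2 * (B y - Num.sqrt (A y) / 2) * (y *m (M - M^T)) 0 l.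

Lemma posdef_unitmx : a \in unitmx.
Proof.
apply: unitmx_inj => v va; apply/eqP; apply: contraT => /apos.
by rewrite /quad va dot0l ltxx.
Qed.

Lemma invmx_sym : (invmx a)^T = invmx a.
Proof. by rewrite trmx_inv asym. Qed.

Lemma bu_mul : bu *m a = b.
Proof. by rewrite mulmxKV // posdef_unitmx. Qed.

Lemma dot_bu_lower y : dot bu (y *m a) = B y.
Proof. by rewrite dotC dot_mulmx asym bu_mul dotC. Qed.

Lemma quad_ge0 y : 0 <= A y.
Proof. by have [->|/apos/ltW //] := eqVneq y 0; rewrite quad0. Qed.

Lemma quad_bu : A bu = b2.
Proof. by rewrite /quad bu_mul dotC. Qed.

(* r_00 = b_{i|j} y^i y^j, since Gamma^k_{ij} y^i y^j = 2 G^k. *)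
Definition r00 y := quad M y - 2 * dot bu (G y).

Lemma r00_quad : r00 =1 quad (M - \sum_l (2 * bu 0 l) *: N l).
Proof.
move=> y; rewrite /r00 -[in RHS]scaleN1r quad_addmx quad_scalemx mulN1r; congr (_ - _).
rewrite /dot mulr_sumr /quad mulmx_sumr /dot.
under [RHS]eq_bigr => i _ do rewrite summxE mulr_suml.
rewrite exchange_big /=; apply: eq_bigr => l _.
rewrite [G y 0 l]mxE /quad /dot !mulr_sumr; apply: eq_bigr => i _.
by rewrite -scalemxAr [in RHS](mxE _ _ 0 i) !mulrA.
Qed.

(** The three summands vanish separately: in the first two a covector has its component along [y]
    removed, and [M - M^T] is antisymmetric. *)
Lemma hamel_residual_dot y : dot y (\row_l hamel_residual y l) = 0.
Proof.
have -> : \row_l hamel_residual y l =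
  (A y * quad M y - 2 * B y * dot y (G y)) *: (A y *: b - B y *: (y *m a))
  - (A y + B y ^+ 2) *: (A y *: G y - dot y (G y) *: (y *m a))
  + (A y ^+ 2 * (B y - Num.sqrt (A y) / 2)) *: (y *m (M - M^T)).
  by apply/rowP => l; rewrite /hamel_residual [y *m (M - M^T)]lock !mxE.
have curl_y : dot y (y *m (M - M^T)) = 0.
  by rewrite mulmxBr dotDr dotNr -dot_mulmx (dotC y) subrr.
rewrite !(dotDr, dotNr, dotZr) curl_y (dotC y b) (dotC y (y *m a)) -/(A y); ring.
Qed.

(** The terms in [th] cancel. With the coefficients [2 * b2 - 1] and [3] the first factor becomes -
    t A (A + B^2), while A G_l - (y.G) y_l is - t A (A b_l - B y_l), so the two products cancel. *)
Lemma hamel_residual_eq0 t th y : M^T = M ->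
  G y = th *: (y *m a) - (t * A y) *: b ->
  r00 y = t * ((2 * b2 - 1) * A y - 3 * B y ^+ 2) ->
  forall l, hamel_residual y l = 0.
Proof.
move=> Msym GE rE l; rewrite /hamel_residual.
have -> : (y *m (M - M^T)) 0 l = 0 by rewrite Msym subrr mulmx0 mxE.
have gE : dot y (G y) = th * A y - t * A y * B y.
  by rewrite GE !dotE (dotC y b) (dotC y (y *m a)).
have bE : dot bu (G y) = th * B y - t * A y * b2.
  by rewrite GE !dotE dot_bu_lower.
have qE : quad M y = r00 y + 2 * dot bu (G y) by rewrite /r00 subrK.
have -> : G y 0 l = th * (y *m a) 0 l - t * A y * b 0 l.
  by rewrite GE !mxE.
by rewrite qE rE bE gE; ring.
Qed.

Variables (D : 'rV[R]_n -> Prop) (y0 : 'rV[R]_n).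
Hypothesis oD : forall v, exists2 e : R, 0 < e & forall t, `|t| < e -> D (y0 + t *: v).
Hypothesis hamel0 : forall y, D y -> forall l, hamel_residual y l = 0.

Lemma line_poly_spray_l l : line_poly (fun y => G y 0 l).
Proof.
by move=> u v; have [p pE] := line_poly_quad (N l) u v; exists p => t; rewrite mxE.
Qed.

Lemma line_poly_spray_y : line_poly (fun y => dot y (G y)).
Proof.
apply: line_poly_sum => l; apply: line_poly_mul; last exact: line_poly_spray_l.
by move=> u v; have [p pE] := line_poly_coord 1%:M l u v; exists p => t; rewrite -pE mulmx1.
Qed.

Lemma curl0 : M^T = M.
Proof.
apply/eqP; rewrite eq_sym -subr_eq0; apply/eqP/row_matrixP => k.
rewrite row0 rowE; apply/rowP => l; rewrite [RHS]mxE.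
(* Twice the polynomial part of the residual, so that its vanishing reads P = alpha [Mf] on [D]. *)
pose P y := 2 * ((A y * quad M y - 2 * B y * dot y (G y)) * (A y * b 0 l - B y * (y *m a) 0 l)
  - (A y + B y ^+ 2) * (A y * G y 0 l - dot y (G y) * (y *m a) 0 l)
  + A y ^+ 2 * B y * (y *m (M - M^T)) 0 l).
have k0 : delta_mx 0 k != 0 :> 'rV[R]_n.
  by apply/eqP => /rowP /(_ k); rewrite !mxE !eqxx => /eqP; rewrite oner_eq0.
pose Mf y := A y ^+ 2 * (y *m (M - M^T)) 0 l.
have : Mf (delta_mx 0 k) = 0.
  apply: (line_poly_sqrt_eq0 n2 apos oD (P := P) (M := Mf) _ _ _ k0).
  - repeat first [exact: line_poly_const | exact: line_poly_quad | exact: line_poly_dot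
    | exact: line_poly_coord | exact: line_poly_spray_l | exact: line_poly_spray_y
    | apply: line_poly_sqr | apply: line_poly_sub | apply: line_poly_add | apply: line_poly_mul].
  - repeat first [exact: line_poly_quad | exact: line_poly_coord
    | apply: line_poly_sqr | apply: line_poly_mul].
  - move=> y /hamel0 /(_ l); rewrite /hamel_residual => /eqP; rewrite addr_eq0 => /eqP e.
    by rewrite /P /Mf e; field.
by move/eqP; rewrite mulf_eq0 expf_eq0 (gt_eqF (apos k0)) /= => /eqP.
Qed.

Lemma hamel_everywhere y l :
  (A y * quad M y - 2 * B y * dot y (G y)) * (A y * b 0 l - B y * (y *m a) 0 l)
  = (A y + B y ^+ 2) * (A y * G y 0 l - dot y (G y) * (y *m a) 0 l).
Proof.
apply/eqP; rewrite -subr_eq0; apply/eqP; move: y.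
apply: (line_poly_eq0 oD).
  repeat first [exact: line_poly_const | exact: line_poly_quad | exact: line_poly_dot
    | exact: line_poly_coord | exact: line_poly_spray_l | exact: line_poly_spray_y
    | apply: line_poly_sqr | apply: line_poly_sub | apply: line_poly_add | apply: line_poly_mul].
move=> y /hamel0 /(_ l) <-; rewrite /hamel_residual.
have -> : (y *m (M - M^T)) 0 l = 0 by rewrite curl0 subrr mulmx0 mxE.
by rewrite mulr0 addr0.
Qed.

(** This is where Q arises: replacing [quad M] by r_00 + 2 b^l G_l makes A b^l G_l - B (y.G) appear
    on both sides, and its total coefficient is (A + B^2) - 2 (A b^2 - B^2) = - Q. *)
Lemma hamel_contracted y :
  (A y * b2 - B y ^+ 2) * (A y * r00 y)
  = - ((2 * b2 - 1) * A y - 3 * B y ^+ 2) * (A y * dot bu (G y) - B y * dot y (G y)).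
Proof.
pose c1 := A y * quad M y - 2 * B y * dot y (G y).
have e : c1 *: (A y *: b - B y *: (y *m a))
  = (A y + B y ^+ 2) *: (A y *: G y - dot y (G y) *: (y *m a)).
  by apply/rowP => l; have := hamel_everywhere y l; rewrite !mxE.
have := congr1 (dot bu) e; rewrite /c1 !dotE dot_bu_lower /r00; lra.
Qed.

Local Notation Q := (fun y : 'rV[R]_n => (2 * b2 - 1) * A y - 3 * B y ^+ 2).

Hypothesis b2_gt : 1 < 2 * b2.

Let b2_gt0 : 0 < b2.
Proof. move: b2_gt; lra. Qed.

Lemma r00_null_cone y : y != 0 -> Q y = 0 -> r00 y = 0.
Proof.
move=> /apos A0 Q0; have := hamel_contracted y; rewrite mulNr Q0 mul0r oppr0.
(* On the null cone of Q this Cauchy-Schwarz gap equals A (b^2 + 1) / 3. *)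
have K0 : 0 < A y * b2 - B y ^+ 2.
  have := mulr_gt0 A0 b2_gt0; move: Q0 => /=; lra.
by move/eqP; rewrite !mulf_eq0 (gt_eqF K0) (gt_eqF A0) /= => /eqP.
Qed.

(** The only possible value: evaluate r_00 = tau Q at b^#, where Q = (2 b^2 - 1) b^2 - 3 b^4 = - b^2
    (b^2 + 1). *)
Definition hamel_tau : R := - r00 bu / (b2 * (b2 + 1)).

(* Q is indefinite: every w orthogonal to b^# lies on a pair of null vectors
   w + t b^# and w - t b^#, and the vanishing of r00 on both determines r00. *)
Lemma r00_tau y : r00 y = hamel_tau * Q y.
Proof.
have b21 : 0 < b2 + 1 by move: b2_gt0; lra.
have b2n : b2 != 0 by rewrite gt_eqF.
have b21n : b2 + 1 != 0 by rewrite gt_eqF.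
have bb : dot b bu = b2 by exact: dotC.
pose c := B y / b2; pose w := y - c *: bu.
have bw : dot b w = 0 by rewrite /w !dotE bb /c; field.
have yE : y = c *: bu + w by rewrite addrC subrK.
clearbody w.
have [L LE] : exists L, forall t, r00 (t *: bu + w) = t ^+ 2 * r00 bu + r00 w + t * L.
  eexists => t; rewrite !r00_quad quadD quadZ -scalemxAl !dotE -mulrDr; reflexivity.
have AE t : A (t *: bu + w) = t ^+ 2 * b2 + A w.
  rewrite quadD quadZ -scalemxAl bu_mul !dotE bw (dotC _ bu) dot_bu_lower bw quad_bu; ring.
have BE t : B (t *: bu + w) = t * b2 by rewrite !dotE bw bb; ring.
have [w0|w_n0] := eqVneq w 0.
  rewrite yE w0 addr0 r00_quad quadZ -r00_quad quadZ dotZr quad_bu bb /hamel_tau.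
  by field; rewrite b2n b21n.
have Aw := apos w_n0.
(* The value of t^2 at which Q(t b^# + w) = - t^2 b^2 (b^2 + 1) + (2 b^2 - 1) A(w) vanishes; it is
   positive because 2 b^2 > 1. *)
pose k := (2 * b2 - 1) * A w / (b2 * (b2 + 1)).
have k0 : 0 < k.
  by rewrite divr_gt0 ?mulr_gt0 //; move: b2_gt; lra.
pose t := Num.sqrt k; have t0 : 0 < t by rewrite sqrtr_gt0.
have tk : t ^+ 2 = k by rewrite sqr_sqrtr // ltW.
have null s : s ^+ 2 = k -> r00 (s *: bu + w) = 0.
  move=> sk; apply: r00_null_cone.
    apply/eqP => e; have := BE s; rewrite e dot0r => /esym/eqP.
    rewrite mulf_eq0 (negPf b2n) orbF => /eqP s0.
    by move: k0; rewrite -sk s0 expr0n ltxx.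
  by rewrite AE BE exprMn sk /k; field; rewrite b2n b21n.
have := null t tk; have := null (- t); rewrite sqrrN => /(_ tk).
rewrite !LE sqrrN tk => e1 e2.
have L0 : L = 0.
  by apply: (mulfI (lt0r_neq0 t0)); rewrite mulr0; move: e1 e2; lra.
rewrite {1}yE LE L0 {1}yE AE {1}yE BE mulr0 addr0 /hamel_tau.
have -> : r00 w = - k * r00 bu by move: e2; rewrite L0 mulr0; lra.
by rewrite /k; field; rewrite b2n b21n.
Qed.

Hypothesis D_Q : forall y, D y -> y != 0 /\ 0 < Q y.

(** Solving for the spray cancels the factors Q and A + B^2. The first may vanish, so this is done
    on [D], where Q is positive; the outcome is again polynomial and extends to all [y]. *)
Lemma spray_tau y l :
  A y * G y 0 l - dot y (G y) * (y *m a) 0 l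
  = - hamel_tau * A y * (A y * b 0 l - B y * (y *m a) 0 l).
Proof.
apply/eqP; rewrite -subr_eq0; apply/eqP; move: y.
apply: (line_poly_eq0 oD).
  repeat first [exact: line_poly_const | exact: line_poly_quad | exact: line_poly_dot
    | exact: line_poly_coord | exact: line_poly_spray_l | exact: line_poly_spray_y
    | apply: line_poly_sqr | apply: line_poly_sub | apply: line_poly_add | apply: line_poly_mul].
move=> y /D_Q [/apos A0 Q0].
have Cc : A y * dot bu (G y) - B y * dot y (G y)
    = - hamel_tau * (A y * b2 - B y ^+ 2) * A y.
  apply: (mulfI (lt0r_neq0 Q0)); have := hamel_contracted y; rewrite r00_tau; lra.
have AB0 : 0 < A y + B y ^+ 2 by rewrite ltr_wpDr // sqr_ge0.
apply: (mulfI (lt0r_neq0 AB0)); rewrite mulr0 mulrBr -hamel_everywhere.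
have q : quad M y = r00 y + 2 * dot bu (G y) by rewrite /r00 subrK.
rewrite q r00_tau.
have -> : A y * (hamel_tau * Q y + 2 * dot bu (G y)) - 2 * B y * dot y (G y)
   = A y * (hamel_tau * Q y) + 2 * (A y * dot bu (G y) - B y * dot y (G y)) by ring.
rewrite Cc; ring.
Qed.

End PointwiseHamel.

(** For independent [u] and [v], the parallelogram law compares coefficients: th(u+v) + th(u-v) = 2
    th(u) and th(u+v) - th(u-v) = 2 th(v), whose sum is additivity. Dependent vectors are settled by
    homogeneity. The value [th 0] is prescribed because [Z] does not determine it. *)
Lemma quadratic_radial (F : numFieldType) (n : nat) (Z : 'rV[F]_n -> 'rV[F]_n)
    (th : 'rV[F]_n -> F) :
  (forall u v, Z (u + v) + Z (u - v) = 2 *: Z u + 2 *: Z v) ->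
  (forall c u, Z (c *: u) = c ^+ 2 *: Z u) ->
  th 0 = 0 -> (forall y, Z y = th y *: y) ->
  forall y, Z y = dot (\row_p Z (delta_mx 0 p) 0 p) y *: y.
Proof.
move=> Zpar Zhom th0 Zth.
have thZ c y : th (c *: y) = c * th y.
  have [->|c0] := eqVneq c 0; first by rewrite scale0r mul0r.
  have [->|y0] := eqVneq y 0; first by rewrite scaler0 th0 mulr0.
  have := Zhom c y; rewrite !Zth !scalerA => /eqP; rewrite -subr_eq0 -scalerBl.
  rewrite scaler_eq0 (negPf y0) orbF subr_eq0 => /eqP e.
  by apply: (mulIf c0); rewrite e; ring.
have thD u v : th (u + v) = th u + th v.
  have [->|u0] := eqVneq u 0; first by rewrite add0r th0 add0r.
  have [i ui] : exists i, u 0 i != 0.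
    apply/existsP; rewrite -negb_forall; apply: contra u0 => /forallP h.
    by apply/eqP/rowP => i; rewrite mxE; apply/eqP.
  pose c := v 0 i / u 0 i.
  have [->|vc] := eqVneq v (c *: u).
    by rewrite -{1}[u]scale1r -scalerDl !thZ; ring.
  have [j vj] : exists j, v 0 j != c * u 0 j.
    apply/existsP; rewrite -negb_forall; apply: contra vc => /forallP h.
    by apply/eqP/rowP => j; rewrite mxE; apply/eqP.
  have free p q : p *: u + q *: v = 0 -> p = 0 /\ q = 0.
    move=> /rowP e; have ei := e i; have ej := e j; rewrite !mxE in ei ej.
    have q0 : q = 0.
      have : q * (v 0 j - c * u 0 j) = 0.
        have pE : p = - q * c.
          by apply: (mulIf ui); rewrite /c mulrA divfK // mulNr; apply/eqP; rewrite -addr_eq0 ei.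
        by rewrite -ej pE; ring.
      by move/eqP; rewrite mulf_eq0 subr_eq0 (negPf vj) orbF => /eqP.
    split=> //; move: ei; rewrite q0 mul0r addr0 => /eqP.
    by rewrite mulf_eq0 (negPf ui) orbF => /eqP.
  have : (th (u + v) + th (u - v) - 2 * th u) *: u
       + (th (u + v) - th (u - v) - 2 * th v) *: v = 0.
    have := Zpar u v; rewrite !Zth => /rowP e; apply/rowP => l.
    have := e l; rewrite !mxE => /eqP; rewrite -subr_eq0 => /eqP <-; ring.
  move=> /free [e1 e2]; apply: (@mulfI _ 2); first by rewrite pnatr_eq0.
  by apply/eqP; rewrite -subr_eq0 -[X in _ == X](addr0 0) -{1}e1 -e2; apply/eqP; ring.
move=> y; rewrite Zth; congr (_ *: _).
have E p : (\row_p Z (delta_mx 0 p) 0 p) 0 p = th (delta_mx 0 p).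
  by rewrite mxE Zth !mxE !eqxx mulr1.
rewrite {1}(row_sum_delta y) (big_morph th thD th0); apply: eq_bigr => i _.
by rewrite thZ E mulrC.
Qed.

(** * Directional derivatives *)

Section DirectionalDerivatives.
Context {R : realType} {V : normedModType R}.
Implicit Types (f g : V -> R) (p v : V).

Lemma is_derive_ext f g p v df :
  g =1 f -> is_derive p v f df -> is_derive p v g df.
Proof. by move=> /funext ->. Qed.

Lemma is_derive_const (c : R) p v : is_derive p v (fun _ : V => c) 0.
Proof. exact: is_derive_cst. Qed.

Lemma is_derive_add f g p v df dg : is_derive p v f df -> is_derive p v g dg ->
  is_derive p v (fun q => f q + g q) (df + dg).
Proof. exact: is_deriveD. Qed.

Lemma is_derive_sub f g p v df dg : is_derive p v f df -> is_derive p v g dg ->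
  is_derive p v (fun q => f q - g q) (df - dg).
Proof. exact: is_deriveB. Qed.

Lemma is_derive_mul f g p v df dg : is_derive p v f df -> is_derive p v g dg ->
  is_derive p v (fun q => f q * g q) (f p * dg + g p * df).
Proof. exact: is_deriveM. Qed.

Lemma is_derive_sqr f p v df : is_derive p v f df ->
  is_derive p v (fun q => f q ^+ 2) (2 * f p * df).
Proof.
by move=> h; apply: (is_derive_eq (is_derive_mul h h)); rewrite -/(f p); ring.
Qed.

Lemma is_derive_inv f p v df : f p != 0 -> is_derive p v f df ->
  is_derive p v (fun q => (f q)^-1) (- df / f p ^+ 2).
Proof.
move=> f0 [h <-]; apply: DeriveDef; first exact: derivableV.
by rewrite deriveV // /GRing.scale /= mulNr mulrC mulNr.
Qed.

Lemma is_derive_bigsum n (f : 'I_n -> V -> R) p v (df : 'I_n -> R) :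
  (forall i, is_derive p v (f i) (df i)) ->
  is_derive p v (fun q => \sum_i f i q) (\sum_i df i).
Proof.
move=> h; have := is_derive_sum h.
by rewrite (_ : \sum_i f i = fun q => \sum_i f i q) //; apply/funext => q; rewrite fct_sumE.
Qed.

(** A derivative along [v] is an ordinary derivative at 0 of the restriction to the line, to which
    the one-variable chain rule applies. *)
Lemma is_derive_sqrt f p v df : 0 < f p -> is_derive p v f df ->
  is_derive p v (fun q => Num.sqrt (f q)) (df / (2 * Num.sqrt (f p))).
Proof.
move=> f0 [h hd].
pose F (t : R) := f (t *: v + p).
have F0 : F 0 = f p by rewrite /F scale0r add0r.
have dF : is_derive (0 : R) 1 F df.
  apply: DeriveDef; first exact: (derivable1P f p v).1 h.
  rewrite -hd /derive /F /=; congr (lim _).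
  by rewrite scale0r add0r; under [in LHS]eq_fun do rewrite addr0 [_ *: 1]mulr1.
have S0 : is_derive (F 0) 1 Num.sqrt (2 * Num.sqrt (F 0))^-1.
  by apply: is_derive1_sqrt; rewrite F0.
have [hc hcd] := is_derive1_comp S0 dF.
apply: DeriveDef; first exact: (derivable1P _ p v).2 hc.
rewrite mulrC -F0 -hcd /derive /=; congr (lim _).
by rewrite /F scale0r !add0r; under [in RHS]eq_fun do rewrite addr0 [_ *: 1]mulr1.
Qed.

End DirectionalDerivatives.

Section GoldenDerivatives.
Context {R : realType} {V : normedModType R}.
Implicit Types (A B Y W : V -> R) (p v : V).

(** With phi = s^2 - s - 1 this is dF = (phi - s phi') d alpha + phi' d beta, where phi - s phi' = -
    (1 + s^2), phi' = 2 s - 1 and d alpha = dA / (2 alpha). The space [V] is left general, since the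
    formula serves for derivatives in x and in y. *)
Lemma is_derive_golden A B p v dA dB : 0 < A p ->
  is_derive p v A dA -> is_derive p v B dB ->
  is_derive p v (fun q => Num.sqrt (A q) *
      ((B q / Num.sqrt (A q)) ^+ 2 - B q / Num.sqrt (A q) - 1))
    (- (1 + (B p / Num.sqrt (A p)) ^+ 2) * (dA / (2 * Num.sqrt (A p)))
     + (2 * (B p / Num.sqrt (A p)) - 1) * dB).
Proof.
move=> A0 hA hB; have s0 : Num.sqrt (A p) != 0 by rewrite gt_eqF ?sqrtr_gt0.
have hS := is_derive_sqrt A0 hA.
have hs := is_derive_mul hB (is_derive_inv (f := fun q => Num.sqrt (A q)) s0 hS).
have h := is_derive_mul hS (is_derive_sub (is_derive_sub (is_derive_sqr hs) hs) (is_derive_const 1 p v)).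
by apply: (is_derive_eq h); field.
Qed.

(* The fiber derivative F_{y^l} is this expression with A = alpha^2, B = beta,
   Y = y_l and W = b_l. *)
Lemma is_derive_golden_fiber A B Y W p v dA dB dY dW : 0 < A p ->
  is_derive p v A dA -> is_derive p v B dB ->
  is_derive p v Y dY -> is_derive p v W dW ->
  let al := Num.sqrt (A p) in let s := B p / al in
  is_derive p v (fun q =>
      - (1 + (B q / Num.sqrt (A q)) ^+ 2) * (Y q / Num.sqrt (A q))
      + (2 * (B q / Num.sqrt (A q)) - 1) * W q)
    (2 * (W p - s * Y p / al) * (dB / al - s * dA / (2 * al ^+ 2))
     - (1 + s ^+ 2) / al * (dY - Y p * dA / (2 * al ^+ 2)) + (2 * s - 1) * dW).
Proof.
move=> A0 hA hB hY hW al s; have s0 : al != 0 by rewrite gt_eqF ?sqrtr_gt0.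
have hi := is_derive_inv (f := fun q => Num.sqrt (A q)) s0 (is_derive_sqrt A0 hA).
have hs := is_derive_mul hB hi.
have c c0 := is_derive_const (c0 : R) p v.
have -> : (fun q =>
      - (1 + (B q / Num.sqrt (A q)) ^+ 2) * (Y q / Num.sqrt (A q))
      + (2 * (B q / Num.sqrt (A q)) - 1) * W q) = (fun q =>
      (2 * (B q / Num.sqrt (A q)) - 1) * W q -
       (1 + (B q / Num.sqrt (A q)) ^+ 2) * (Y q / Num.sqrt (A q))).
  by apply/funext => q; ring.
have h1 := is_derive_mul (is_derive_sub (is_derive_mul (c 2) hs) (c 1)) hW.
have h2 := is_derive_mul (is_derive_add (c 1) (is_derive_sqr hs)) (is_derive_mul hY hi).
by apply: (is_derive_eq (is_derive_sub h1 h2)); rewrite /s /al; field.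
Qed.

End GoldenDerivatives.

Section PointDerivatives.
Context {R : realType} {n : nat}.
Implicit Types (x y v : 'rV[R]_n) (a : 'rV[R]_n -> 'M[R]_n) (b : 'rV[R]_n -> 'rV[R]_n).

Lemma smooth_is_derive (U : set 'rV[R]_n) f x k : smooth_on U f -> U x ->
  is_derive x (delta_mx 0 k) f (partial k f x).
Proof. by move=> /(_ [::] x) h Ux; apply/derivableP/diff_derivable/h. Qed.

Lemma is_derive_partial f x k df :
  is_derive x (delta_mx 0 k) f df -> partial k f x = df.
Proof. by move=> [_]. Qed.

Lemma near_eq_partial f g x k : (\forall z \near x, f z = g z) ->
  partial k f x = partial k g x.
Proof. exact: near_eq_derive. Qed.

Lemma near_neq0 y : y != 0 -> \forall z \near y, z != 0.
Proof. by move=> y0; apply: (@cvgr_neq0 _ _ _ (nbhs y) _ id y). Qed.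

Lemma is_derive_coord y v i : is_derive y v (fun z : 'rV[R]_n => z 0 i) (v 0 i).
Proof.
have h : differentiable (fun z : 'rV[R]_n => z 0 i) y by exact: differentiable_coord.
apply: DeriveDef; first exact: diff_derivable.
apply: cvg_lim => //; apply: cvg_near_cst.
apply: filterS (nbhs_dnbhs_neq (0 : R)) => t t0 /=.
by rewrite !mxE addrK /GRing.scale /= mulKf.
Qed.

Lemma is_derive_dot y v (c : 'rV[R]_n) : is_derive y v (dot c) (dot c v).
Proof.
have h i := is_derive_mul (is_derive_const (c 0 i) y v) (is_derive_coord y v i).
apply: (is_derive_eq (is_derive_bigsum h)).
by apply: eq_bigr => i _; rewrite mulr0 addr0.
Qed.

Lemma is_derive_lower y v (N : 'M[R]_n) l :
  is_derive y v (fun z : 'rV[R]_n => (z *m N) 0 l) ((v *m N) 0 l).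
Proof.
have -> : (fun z : 'rV[R]_n => (z *m N) 0 l) = dot (delta_mx 0 l *m N^T).
  by apply/funext => z; rewrite dotC -dot_mulmx dot_delta.
apply: is_derive_eq (is_derive_dot _ _ _) _.
by rewrite dotC -dot_mulmx dot_delta.
Qed.

Lemma is_derive_quad y v (N : 'M[R]_n) : N^T = N ->
  is_derive y v (quad N) (2 * dot (y *m N) v).
Proof.
move=> sN; have h i := is_derive_mul (is_derive_lower y v N i) (is_derive_coord y v i).
apply: (is_derive_eq (is_derive_bigsum h)).
transitivity (dot (y *m N) v + dot y (v *m N)); first by rewrite -big_split.
by rewrite -{2}sN -dot_mulmx; ring.
Qed.

Lemma is_derive_mx_quad a x v y da :
  (forall i j, is_derive x v (fun x' => a x' i j) (da i j)) ->
  is_derive x v (fun x' => quad (a x') y) (quad (\matrix_(i, j) da i j) y).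
Proof.
move=> h; have -> : (fun x' => quad (a x') y)
    = fun x' => \sum_i \sum_j a x' i j * (y 0 i * y 0 j).
  by apply/funext => z; rewrite quadE; do 2!apply: eq_bigr => ? _; rewrite mulrA.
have h1 i j := is_derive_mul (h i j) (is_derive_const (y 0 i * y 0 j) x v).
have h2 i := is_derive_bigsum (h1 i).
apply: (is_derive_eq (is_derive_bigsum h2)).
rewrite quadE; do 2!apply: eq_bigr => ? _; rewrite mxE /=; ring.
Qed.

Lemma is_derive_mx_lower a x v y da l :
  (forall i j, is_derive x v (fun x' => a x' i j) (da i j)) ->
  is_derive x v (fun x' => (y *m a x') 0 l) ((y *m \matrix_(i, j) da i j) 0 l).
Proof.
move=> h; have -> : (fun x' => (y *m a x') 0 l) = fun x' => \sum_i y 0 i * a x' i l.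
  by apply/funext => z; rewrite mxE.
have h1 i := is_derive_mul (is_derive_const (y 0 i) x v) (h i l).
apply: (is_derive_eq (is_derive_bigsum h1)).
by rewrite mxE; apply: eq_bigr => ? _; rewrite mxE /=; ring.
Qed.

Lemma is_derive_form b x v y db :
  (forall i, is_derive x v (fun x' => b x' 0 i) (db i)) ->
  is_derive x v (fun x' => dot (b x') y) (dot (\row_i db i) y).
Proof.
move=> h; have h1 i := is_derive_mul (h i) (is_derive_const (y 0 i) x v).
apply: (is_derive_eq (is_derive_bigsum h1)).
by apply: eq_bigr => ? _; rewrite mxE /=; ring.
Qed.

End PointDerivatives.

(** * The fundamental tensor *)

Section OuterProduct.
Context {R : comNzRingType} {n : nat}.
Implicit Types (u v w : 'rV[R]_n).

Lemma outerE u w i j : (u^T *m w) i j = u 0 i * w 0 j.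
Proof. by rewrite mxE big_ord1 mxE. Qed.

Lemma mul_outer v u w : v *m (u^T *m w) = dot v u *: w.
Proof.
rewrite mulmxA; apply/rowP => l; rewrite mxE big_ord1 !mxE; congr (_ * _).
by apply: eq_bigr => i _; rewrite mxE.
Qed.

End OuterProduct.

Section GoldenTensor.
Context {R : rcfType} {n : nat}.
Variables (a : 'M[R]_n) (b y : 'rV[R]_n).
Hypothesis asym : a^T = a.
Hypothesis apos : forall z : 'rV[R]_n, z != 0 -> 0 < quad a z.
Hypothesis y0 : y != 0.

Local Notation al := (Num.sqrt (quad a y)).
Local Notation s := (dot b y / al).
Local Notation F := (al * (s ^+ 2 - s - 1)).
Local Notation c := (b - (s / al) *: (y *m a)).

Definition golden_dy : 'rV[R]_n :=
  \row_l (- (1 + s ^+ 2) * ((y *m a) 0 l / al) + (2 * s - 1) * b 0 l).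

Lemma golden_dy_coord l : golden_dy 0 l =
  - (1 + s ^+ 2) * ((y *m a) 0 l / al) + (2 * s - 1) * b 0 l.
Proof. by rewrite mxE. Qed.

(** The closed form of F_{y^i} F_{y^j} + F F_{y^i y^j}: here [c] is alpha times the fiber gradient
    of s, the constant 2 is phi'', and - (1 + s^2) is phi - s phi'. *)
Definition golden_tensor : 'M[R]_n :=
  golden_dy^T *m golden_dy + (F * 2 / al) *: (c^T *m c)
  - (F * (1 + s ^+ 2) / al) *: (a - (al ^- 2) *: ((y *m a)^T *m (y *m a))).

Let al0 : al != 0.
Proof. by rewrite gt_eqF // sqrtr_gt0 apos. Qed.

Let al2 : quad a y = al ^+ 2.
Proof. by rewrite sqr_sqrtr // ltW // apos. Qed.

Lemma golden_dyE : golden_dy = - ((1 + s ^+ 2) / al) *: (y *m a) + (2 * s - 1) *: b.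
Proof. by apply/rowP => l; rewrite !mxE; ring. Qed.

Lemma golden_tensorE i j : golden_tensor i j =
  golden_dy 0 i * golden_dy 0 j + F * 2 / al * (c 0 i * c 0 j)
  - F * (1 + s ^+ 2) / al * (a i j - al ^- 2 * ((y *m a) 0 i * (y *m a) 0 j)).
Proof.
have gen (u v w : 'rV[R]_n) k1 k2 k3 :
  (u^T *m u + k1 *: (v^T *m v) - k2 *: (a - k3 *: (w^T *m w))) i j
  = u 0 i * u 0 j + k1 * (v 0 i * v 0 j) - k2 * (a i j - k3 * (w 0 i * w 0 j)).
  by rewrite !(outerE, mxE).
exact: gen.
Qed.

Lemma golden_tensor_sym : golden_tensor^T = golden_tensor.
Proof.
apply/matrixP => i j; have aij : a j i = a i j by rewrite -{1}asym mxE.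
by rewrite [LHS]mxE !golden_tensorE aij; ring.
Qed.

Lemma dot_y_lower : dot y (y *m a) = al ^+ 2.
Proof. by rewrite dotC -al2. Qed.

Lemma dot_y_form : dot y b = s * al.
Proof. by rewrite divfK // dotC. Qed.

Lemma golden_euler : dot y golden_dy = F.
Proof. by rewrite golden_dyE !dotE dot_y_lower dot_y_form; field. Qed.

Lemma dot_y_c : dot y c = 0.
Proof. by rewrite !dotE dot_y_lower dot_y_form; field. Qed.

Lemma mul_golden_tensor v : v *m golden_tensor =
  dot v golden_dy *: golden_dy + (F * 2 / al * dot v c) *: c
  - (F * (1 + s ^+ 2) / al) *: (v *m a - (al ^- 2 * dot v (y *m a)) *: (y *m a)).
Proof.
have gen (u w z : 'rV[R]_n) k1 k2 k3 :
  v *m (u^T *m u + k1 *: (w^T *m w) - k2 *: (a - k3 *: (z^T *m z)))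
  = dot v u *: u + (k1 * dot v w) *: w - k2 *: (v *m a - (k3 * dot v z) *: z).
  by rewrite mulmxBr mulmxDr -!scalemxAr mulmxBr -scalemxAr !mul_outer !scalerA.
exact: gen.
Qed.

Lemma y_golden_tensor : y *m golden_tensor = F *: golden_dy.
Proof.
rewrite mul_golden_tensor golden_euler dot_y_c dot_y_lower mulr0 scale0r addr0.
by rewrite mulVf ?expf_neq0 // scale1r subrr scaler0 subr0.
Qed.

(* On the complement of y the kernel equation reads
   (1 + s^2) v_l = 2 (c.v) c_l, and c.c = b^2 - s^2, so that contracting with
   c leaves the factor 2 b^2 - 3 s^2 - 1. *)
Lemma golden_tensor_unit :
  0 < s ^+ 2 - s - 1 ->
  0 < 2 * dot (b *m invmx a) b - 3 * s ^+ 2 - 1 ->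
  golden_tensor \in unitmx.
Proof.
move=> phi0 cone; apply: unitmx_inj => v vg.
have F0 : F != 0 by rewrite mulf_neq0 // gt_eqF.
have aU := posdef_unitmx apos.
have Fv : dot v golden_dy = 0.
  have := congr1 (dot^~ y) vg; rewrite dot0l dot_mulmx golden_tensor_sym.
  rewrite y_golden_tensor !dotE => /eqP.
  by rewrite mulf_eq0 (negPf F0) /= => /eqP.
(* [w] is the part of [v] orthogonal to [y] for [a]. Once [w] is zero, [Fv] and Euler's relation
   give m F = 0, which kills the rest. *)
pose m := al ^- 2 * dot v (y *m a); pose w := v - m *: y.
have vE : v = w + m *: y by rewrite subrK.
have wy : dot w (y *m a) = 0.
  by rewrite !dotE dot_y_lower /m; field.
have wc : dot w c = dot v c by rewrite [in LHS]dotDl dotNl dotZl dot_y_c mulr0 subr0.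
have wa : (1 + s ^+ 2) *: (w *m a) = (2 * dot w c) *: c.
  have := vg; rewrite mul_golden_tensor Fv scale0r add0r -/m => /eqP.
  rewrite subr_eq0 => /eqP e.
  have -> : w *m a = v *m a - m *: (y *m a) by rewrite mulmxBl -scalemxAl.
  apply: (scalerI (mulf_neq0 F0 (invr_neq0 al0))).
  rewrite !scalerA wc.
  transitivity ((F * (1 + s ^+ 2) / al) *: (v *m a - m *: (y *m a))).
    by congr (_ *: _); ring.
  by rewrite -e; congr (_ *: _); ring.
pose cu := c *m invmx a.
have cua : cu *m a = c by rewrite mulmxKV.
have cuE : cu = b *m invmx a - (s / al) *: y by rewrite /cu mulmxBl -scalemxAl mulmxK.
have cc : dot c cu = dot (b *m invmx a) b - s ^+ 2.
  rewrite cuE dotDr dotNr dotZr (dotC c y) dot_y_c mulr0 subr0 dotDl dotNl dotZl.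
  rewrite (dotC (y *m a)) (dot_bu_lower b asym apos) (dotC b (_ *m _)).
  by congr (_ - _); field.
have wc0 : dot w c = 0.
  have := congr1 (dot^~ cu) wa; rewrite !dotZl cc dot_mulmx asym cua => e.
  apply/eqP; have : dot w c * (2 * dot (b *m invmx a) b - 3 * s ^+ 2 - 1) = 0.
    by move: e => /eqP; rewrite -subr_eq0 => /eqP e; rewrite -oppr0 -e; ring.
  by move/eqP; rewrite mulf_eq0 (gt_eqF cone) orbF.
have s21 : 1 + s ^+ 2 != 0 by rewrite gt_eqF // ltr_wpDr // sqr_ge0.
have w0 : w = 0.
  move: wa; rewrite wc0 mulr0 scale0r => /eqP; rewrite scaler_eq0 (negPf s21) /= => /eqP wa0.
  by rewrite -[w](mulmxK aU) wa0 mul0mx.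
move: Fv; rewrite vE w0 add0r dotZl golden_euler => /eqP.
by rewrite mulf_eq0 (negPf F0) orbF => /eqP ->; rewrite scale0r.
Qed.

End GoldenTensor.

(** * Sprays *)

Section Sprays.
Context {R : realType} {n : nat}.
Variables (U : set 'rV[R]_n) (a : 'rV[R]_n -> 'M[R]_n) (b : 'rV[R]_n -> 'rV[R]_n).
Hypotheses (U_open : open U) (a_riem : riemannian a U) (b_smooth : smooth_form U b).
Implicit Types (x y : 'rV[R]_n) (i j k l : 'I_n).

Definition dmetric k x : 'M[R]_n := \matrix_(i, j) partial k (fun x' => a x' i j) x.

Definition dform x : 'M[R]_n := \matrix_(k, l) partial k (fun x' => b x' 0 l) x.

(* quad (spray_mx l x) y is a_{li} G^i_alpha(y). *)
Definition spray_mx l x : 'M[R]_n :=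
  \matrix_(k, j) (2^-1 * dmetric k x j l - 4^-1 * dmetric l x k j).

Definition lower_spray x y : 'rV[R]_n := \row_l quad (spray_mx l x) y.

Lemma riemannian_sym x : U x -> (a x)^T = a x.
Proof. by case: a_riem => _ s _ Ux; apply/matrixP => i j; rewrite mxE s. Qed.

Lemma riemannian_pos x : U x -> forall y, y != 0 -> 0 < quad (a x) y.
Proof. by case: a_riem => _ _ p Ux y y0; rewrite quadE p. Qed.

Lemma near_U x : U x -> \forall z \near x, U z.
Proof. by move=> Ux; apply: open_nbhs_nbhs. Qed.

Lemma alphaE : alpha a = fun x y => Num.sqrt (quad (a x) y).
Proof. by apply/funext => x; apply/funext => y; rewrite quadE. Qed.

Lemma sqr_alpha x y : U x -> alpha a x y ^+ 2 = quad (a x) y.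
Proof. by move=> Ux; rewrite alphaE sqr_sqrtr //; apply/quad_ge0/riemannian_pos. Qed.

Lemma goldenE : golden a b = fun x y => Num.sqrt (quad (a x) y) *
  ((dot (b x) y / Num.sqrt (quad (a x) y)) ^+ 2
   - dot (b x) y / Num.sqrt (quad (a x) y) - 1).
Proof. by rewrite /golden /sratio alphaE. Qed.

Lemma sratioE : sratio a b = fun x y => dot (b x) y / Num.sqrt (quad (a x) y).
Proof. by rewrite /sratio alphaE. Qed.

Lemma is_derive_metric k x i j : U x ->
  is_derive x (delta_mx 0 k) (fun x' => a x' i j) (partial k (fun x' => a x' i j) x).
Proof. by case: a_riem => sa _ _; apply: smooth_is_derive. Qed.

Lemma is_derive_dmetric k x y : U x ->
  is_derive x (delta_mx 0 k) (fun x' => quad (a x') y) (quad (dmetric k x) y).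
Proof. by move=> Ux; apply: is_derive_mx_quad => i j; apply: is_derive_metric. Qed.

Lemma is_derive_dlower k x y l : U x ->
  is_derive x (delta_mx 0 k) (fun x' => (y *m a x') 0 l) ((y *m dmetric k x) 0 l).
Proof. by move=> Ux; apply: is_derive_mx_lower => i j; apply: is_derive_metric. Qed.

Lemma is_derive_dform_coord k x l : U x ->
  is_derive x (delta_mx 0 k) (fun x' => b x' 0 l) (dform x k l).
Proof. by move=> Ux; rewrite mxE; apply: (smooth_is_derive (U := U)) => //; apply: b_smooth. Qed.

Lemma is_derive_dform k x y : U x ->
  is_derive x (delta_mx 0 k) (fun x' => dot (b x') y) (dot (row k (dform x)) y).
Proof.
move=> Ux; have := is_derive_form (b := b) y (fun l => is_derive_dform_coord k l Ux).
by congr is_derive; congr dot; apply/rowP => l; rewrite !mxE.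
Qed.

Lemma is_derive_y_quad x y l : U x ->
  is_derive y (delta_mx 0 l) (quad (a x)) (2 * (y *m a x) 0 l).
Proof. by move=> /riemannian_sym /is_derive_quad h; have := h y (delta_mx 0 l); rewrite dot_delta. Qed.

Lemma is_derive_y_dot x y l : is_derive y (delta_mx 0 l) (dot (b x)) (b x 0 l).
Proof. by have := is_derive_dot y (delta_mx 0 l) (b x); rewrite dot_delta. Qed.

Lemma is_derive_y_lower x y i l :
  is_derive y (delta_mx 0 i) (fun z : 'rV[R]_n => (z *m a x) 0 l) (a x i l).
Proof. by have := is_derive_lower y (delta_mx 0 i) (a x) l; rewrite -rowE mxE. Qed.

Lemma sum_dlower x y l : \sum_k (y *m dmetric k x) 0 l * y 0 k
  = 2 * lower_spray x y 0 l + 2^-1 * quad (dmetric l x) y.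
Proof.
rewrite mxE !quadE.
have -> : \sum_k (y *m dmetric k x) 0 l * y 0 k
    = \sum_k \sum_j dmetric k x j l * y 0 k * y 0 j.
  apply: eq_bigr => k _; rewrite mxE mulr_suml; apply: eq_bigr => j _; ring.
rewrite !mulr_sumr -big_split; apply: eq_bigr => k _ /=.
rewrite !mulr_sumr -big_split; apply: eq_bigr => j _ /=.
by rewrite [spray_mx _ _ _ _]mxE; field.
Qed.

Lemma sum_dmetric x y :
  \sum_k quad (dmetric k x) y * y 0 k = 4 * dot y (lower_spray x y).
Proof.
have e : \sum_l (\sum_k (y *m dmetric k x) 0 l * y 0 k) * y 0 l
    = \sum_k quad (dmetric k x) y * y 0 k.
  under eq_bigr => l _ do rewrite mulr_suml.
  rewrite exchange_big; apply: eq_bigr => k _ /=.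
  by rewrite /quad /dot mulr_suml; apply: eq_bigr => l _; rewrite mulrAC.
(* Contracting [sum_dlower] with [y] reproduces the sum on the right with factor 1/2, so the
   equation can be solved for it. *)
have : \sum_k quad (dmetric k x) y * y 0 k
    = 2 * dot y (lower_spray x y) + 2^-1 * \sum_k quad (dmetric k x) y * y 0 k.
  rewrite -{1}e /dot !mulr_sumr -big_split; apply: eq_bigr => l _ /=.
  rewrite sum_dlower; ring.
lra.
Qed.

Lemma fund_tensor_alpha x y : U x -> fund_tensor (alpha a) x y = a x.
Proof.
move=> Ux; apply/matrixP => i j; rewrite mxE.
have -> : partial j (fun y' => alpha a x y' ^+ 2) = fun z => 2 * (z *m a x) 0 j.
  apply/funext => z; have -> : (fun y' => alpha a x y' ^+ 2) = quad (a x).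
    by apply/funext => y'; rewrite sqr_alpha.
  exact/is_derive_partial/is_derive_y_quad.
rewrite (is_derive_partial (is_derive_mul (is_derive_const 2 y _) (is_derive_y_lower x y i j))).
by field.
Qed.

Lemma spray_alphaE x y i : U x ->
  spray (alpha a) i x y = (lower_spray x y *m invmx (a x)) 0 i.
Proof.
move=> Ux; rewrite /spray fund_tensor_alpha // mulr_sumr mxE.
have isym k l : invmx (a x) k l = invmx (a x) l k.
  by rewrite -[in LHS](invmx_sym (riemannian_sym Ux)) mxE.
apply: eq_bigr => l _; rewrite isym.
have e1 : partial l (fun x' => alpha a x' y ^+ 2) x = quad (dmetric l x) y.
  rewrite -(is_derive_partial (is_derive_dmetric l y Ux)); apply: near_eq_partial.
  by apply: filterS (near_U Ux) => z Uz; rewrite sqr_alpha.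
have e2 k : partial k (fun x' => partial l (fun y' => alpha a x' y' ^+ 2) y) x
    = 2 * (y *m dmetric k x) 0 l.
  rewrite -[RHS]addr0 -(mulr0 ((y *m a x) 0 l)).
  rewrite -(is_derive_partial (is_derive_mul (is_derive_const 2 x _) (is_derive_dlower k y l Ux))).
  apply: near_eq_partial.
  apply: filterS (near_U Ux) => z Uz.
  have -> : (fun y' => alpha a z y' ^+ 2) = quad (a z).
    by apply/funext => y'; rewrite sqr_alpha.
  exact/is_derive_partial/is_derive_y_quad.
rewrite e1; under eq_bigr => k _ do rewrite e2 -mulrA.
by rewrite -mulr_sumr sum_dlower; field.
Qed.

Lemma alpha_gt0 x y : U x -> y != 0 -> 0 < alpha a x y.
Proof. by move=> Ux y0; rewrite alphaE sqrtr_gt0 riemannian_pos. Qed.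

Lemma is_derive_golden_y x y l : U x -> y != 0 ->
  is_derive y (delta_mx 0 l) (golden a b x) (golden_dy (a x) (b x) y 0 l).
Proof.
move=> Ux y0; have A0 := riemannian_pos Ux y0.
have s0 : Num.sqrt (quad (a x) y) != 0 by rewrite gt_eqF ?sqrtr_gt0.
rewrite goldenE.
apply: (is_derive_eq (is_derive_golden A0 (is_derive_y_quad y l Ux) (is_derive_y_dot x y l))).
by rewrite golden_dy_coord; field.
Qed.

Lemma is_derive_golden_x x y k : U x -> y != 0 ->
  is_derive x (delta_mx 0 k) (fun x' => golden a b x' y)
   (- (1 + sratio a b x y ^+ 2) * (quad (dmetric k x) y / (2 * alpha a x y))
    + (2 * sratio a b x y - 1) * dot (row k (dform x)) y).
Proof.
move=> Ux y0; have A0 := riemannian_pos Ux y0.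
rewrite goldenE sratioE alphaE.
exact: (is_derive_golden (A := fun x' => quad (a x') y) A0
  (is_derive_dmetric k y Ux) (is_derive_dform k y Ux)).
Qed.

Lemma partial_sqr_golden_y x y l : U x -> y != 0 ->
  partial l (fun y' => golden a b x y' ^+ 2) y
  = 2 * golden a b x y * golden_dy (a x) (b x) y 0 l.
Proof. by move=> Ux y0; apply/is_derive_partial/is_derive_sqr/is_derive_golden_y. Qed.

Lemma fund_tensor_golden x y : U x -> y != 0 ->
  fund_tensor (golden a b) x y = golden_tensor (a x) (b x) y.
Proof.
move=> Ux y0; have A0 := riemannian_pos Ux y0.
have s0 : Num.sqrt (quad (a x) y) != 0 by rewrite gt_eqF ?sqrtr_gt0.
apply/matrixP => i j; rewrite mxE golden_tensorE.
have /= h0 := is_derive_golden_fiber A0 (is_derive_y_quad y i Ux) (is_derive_y_dot x y i)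
  (is_derive_y_lower x y i j) (is_derive_const (b x 0 j) y (delta_mx 0 i)).
have h := is_derive_ext (fun z => golden_dy_coord (a x) (b x) z j) h0.
have -> : partial i (partial j (fun y' => golden a b x y' ^+ 2)) y =
    partial i (fun z => 2 * golden a b x z * golden_dy (a x) (b x) z 0 j) y.
  apply: near_eq_partial; apply: filterS (near_neq0 y0) => z z0.
  exact: partial_sqr_golden_y.
rewrite (is_derive_partial (is_derive_mul (is_derive_mul (is_derive_const 2 y _)
  (is_derive_golden_y i Ux y0)) h)).
rewrite goldenE !mxE; field.
by rewrite s0.
Qed.

Definition spray_rhs x y l : R :=
  (\sum_k partial k (fun x' => partial l (fun y' => golden a b x' y' ^+ 2) y) x * y 0 k)
  - partial l (fun x' => golden a b x' y ^+ 2) x.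

(* (F_{x^k} y^k) / (2 F) *)
Definition golden_proj x y : R :=
  (- (1 + sratio a b x y ^+ 2) * (4 * dot y (lower_spray x y) / (2 * alpha a x y))
   + (2 * sratio a b x y - 1) * quad (dform x) y) / (2 * golden a b x y).

(** The x-derivatives enter linearly, so contraction with y^k needs only the four sums [sA], [sB],
    [sW] and [sY]. The derivative of alpha^2 by x^l contributed by [sY] cancels the one in F_{x^l};
    y^k times the derivative of b_l by x^k and the derivative of beta by x^l combine into the
    curl. *)
Lemma spray_rhsE x y l : U x -> y != 0 -> golden a b x y != 0 ->
  spray_rhs x y l =
  4 * golden_proj x y * golden a b x y * golden_dy (a x) (b x) y 0 l
  + 4 * golden a b x y / alpha a x y ^+ 5
    * hamel_residual (a x) (b x) (dform x) (spray_mx ^~ x) y l.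
Proof.
move=> Ux y0 F0; have A0 := riemannian_pos Ux y0.
have al0 : alpha a x y != 0 by rewrite gt_eqF ?alpha_gt0.
have al2 := sqr_alpha y Ux.
pose al := alpha a x y; pose s := sratio a b x y; pose F := golden a b x y.
pose Y := (y *m a x) 0 l.
have e1 : partial l (fun x' => golden a b x' y ^+ 2) x = 2 * F *
   (- (1 + s ^+ 2) * (quad (dmetric l x) y / (2 * al))
    + (2 * s - 1) * dot (row l (dform x)) y).
  exact/is_derive_partial/is_derive_sqr/is_derive_golden_x.
have e2 k : partial k (fun x' => partial l (fun y' => golden a b x' y' ^+ 2) y) x =
  2 * golden_dy (a x) (b x) y 0 l *
     (- (1 + s ^+ 2) * (quad (dmetric k x) y / (2 * al))
      + (2 * s - 1) * dot (row k (dform x)) y)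
  + 2 * F * (2 * (b x 0 l - s * Y / al)
      * (dot (row k (dform x)) y / al - s * quad (dmetric k x) y / (2 * al ^+ 2))
     - (1 + s ^+ 2) / al * ((y *m dmetric k x) 0 l - Y * quad (dmetric k x) y / (2 * al ^+ 2))
     + (2 * s - 1) * dform x k l).
  have /= h0 := is_derive_golden_fiber (A := fun x' => quad (a x') y) A0 (is_derive_dmetric k y Ux) (is_derive_dform k y Ux)
    (is_derive_dlower k y l Ux) (is_derive_dform_coord k l Ux).
  have h := is_derive_ext (fun z => golden_dy_coord (a z) (b z) y l) h0.
  have -> : partial k (fun x' => partial l (fun y' => golden a b x' y' ^+ 2) y) x =
      partial k (fun z => 2 * golden a b z y * golden_dy (a z) (b z) y 0 l) x.
    apply: near_eq_partial; apply: filterS (near_U Ux) => z Uz.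
    exact: partial_sqr_golden_y.
  rewrite (is_derive_partial (is_derive_mul (is_derive_mul (is_derive_const 2 x _)
    (is_derive_golden_x k Ux y0)) h)).
  rewrite /al /s /F sratioE alphaE -/Y mulr0 addr0; ring.
rewrite /spray_rhs e1; under eq_bigr => k _ do rewrite e2.
have sB : \sum_k dot (row k (dform x)) y * y 0 k = quad (dform x) y.
  rewrite quadE; apply: eq_bigr => k _; rewrite mulr_suml; apply: eq_bigr => j _.
  by rewrite mxE mulrAC.
have sW : \sum_k dform x k l * y 0 k = (y *m dform x) 0 l.
  by rewrite mxE; apply: eq_bigr => k _; rewrite mulrC.
have sA := sum_dmetric x y; have sY := sum_dlower x y l.
have lin : forall (p q r t : R) (f g h m : 'I_n -> R),
   \sum_k (p * f k + q * g k + r * h k + t * m k) * y 0 k =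
   p * (\sum_k f k * y 0 k) + q * (\sum_k g k * y 0 k) + r * (\sum_k h k * y 0 k)
   + t * (\sum_k m k * y 0 k).
  by move=> *; rewrite !mulr_sumr -!big_split; apply: eq_bigr => k _ /=; ring.
have al_sqrt : Num.sqrt (quad (a x) y) = al by rewrite /al alphaE.
have sal : dot (b x) y = s * al by rewrite /s sratioE al_sqrt divfK.
have curl : (y *m (dform x - (dform x)^T)) 0 l
    = (y *m dform x) 0 l - dot (row l (dform x)) y.
  rewrite mulmxBr mxE [X in _ + X]mxE; congr (_ - _).
  by rewrite mxE; apply: eq_bigr => j _; rewrite !mxE mulrC.
pose gdy := golden_dy (a x) (b x) y 0 l; pose c := b x 0 l - s * Y / al.
(* [p] and [q] collect the coefficients of the x^k-derivatives of alpha^2 and of beta. *)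
pose p := - gdy * (1 + s ^+ 2) / al
  + 2 * F * (- (c * s / al ^+ 2) + (1 + s ^+ 2) / al * Y / (2 * al ^+ 2)).
pose q := 2 * gdy * (2 * s - 1) + 4 * F * c / al.
have -> : \sum_k (2 * gdy *
     (- (1 + s ^+ 2) * (quad (dmetric k x) y / (2 * al))
      + (2 * s - 1) * dot (row k (dform x)) y)
  + 2 * F * (2 * c
      * (dot (row k (dform x)) y / al - s * quad (dmetric k x) y / (2 * al ^+ 2))
     - (1 + s ^+ 2) / al * ((y *m dmetric k x) 0 l - Y * quad (dmetric k x) y / (2 * al ^+ 2))
     + (2 * s - 1) * dform x k l)) * y 0 k
  = \sum_k (p * quad (dmetric k x) y + q * dot (row k (dform x)) y
      + - (2 * F * (1 + s ^+ 2) / al) * (y *m dmetric k x) 0 l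
      + 2 * F * (2 * s - 1) * dform x k l) * y 0 k.
  by apply: eq_bigr => k _; congr (_ * _); rewrite /p /q; field.
rewrite lin sA sB sY sW /golden_proj /hamel_residual curl al_sqrt -al2 -/al sal -/s -/F -/gdy.
have -> : \row_l0 quad (spray_mx l0 x) y = lower_spray x y by [].
rewrite /p /q /c -/Y; field.
by rewrite F0 al0.
Qed.

End Sprays.

(** * The residual against the spray of F, and the covariant derivative of beta *)

Section SpraysAndHamel.
Context {R : realType} {n : nat}.
Variables (U : set 'rV[R]_n) (a : 'rV[R]_n -> 'M[R]_n) (b : 'rV[R]_n -> 'rV[R]_n).
Hypotheses (U_open : open U) (a_riem : riemannian a U) (b_smooth : smooth_form U b).
Implicit Types (x y : 'rV[R]_n) (i j k l : 'I_n).

Local Notation residual x := (hamel_residual (a x) (b x) (dform b x) ((spray_mx a)^~ x)).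

Lemma bnorm2E x : bnorm2 a b x = dot (b x *m invmx (a x)) (b x).
Proof. by rewrite /bnorm2 -/(quad (invmx (a x)) (b x)) quadE. Qed.

Lemma b_upE x i : U x -> b_up a b i x = (b x *m invmx (a x)) 0 i.
Proof.
move=> Ux; rewrite mxE; apply: eq_bigr => j _.
by rewrite mulrC -[in LHS](invmx_sym (riemannian_sym a_riem Ux)) mxE.
Qed.

Lemma golden_cone_neq0 x y : U x -> golden_cone a b x y -> golden a b x y != 0.
Proof.
move=> Ux [y0 phi _]; rewrite /golden mulf_neq0 ?gt_eqF //.
exact: (alpha_gt0 a_riem).
Qed.

Lemma fund_tensor_golden_unit x y : U x -> golden_cone a b x y ->
  fund_tensor (golden a b) x y \in unitmx.
Proof.
move=> Ux [y0 phi cone]; rewrite (fund_tensor_golden b a_riem) //.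
apply: golden_tensor_unit => //; [exact: riemannian_sym Ux|exact: riemannian_pos Ux| |].
  by move: phi; rewrite sratioE.
by move: cone; rewrite sratioE bnorm2E.
Qed.

Lemma mul_fund_tensor_golden x y : U x -> golden_cone a b x y ->
  y *m fund_tensor (golden a b) x y = golden a b x y *: golden_dy (a x) (b x) y.
Proof.
move=> Ux [y0 phi cone]; rewrite (fund_tensor_golden b a_riem) // y_golden_tensor //.
  by rewrite goldenE.
exact: riemannian_pos Ux.
Qed.

Lemma spray_goldenE x y i : U x -> golden_cone a b x y ->
  spray (golden a b) i x y = (4^-1 *: \row_l spray_rhs a b x y l
    *m invmx (fund_tensor (golden a b) x y)) 0 i.
Proof.
move=> Ux [y0 phi cone]; rewrite -scalemxAl mxE; congr (_ * _).
have gsym : (fund_tensor (golden a b) x y)^T = fund_tensor (golden a b) x y.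
  by rewrite (fund_tensor_golden b a_riem) // golden_tensor_sym //; exact: riemannian_sym Ux.
rewrite mxE; apply: eq_bigr => l _.
by rewrite -[in LHS]gsym -trmx_inv !mxE mulrC.
Qed.

Lemma spray_golden_residual0 x y : U x -> golden_cone a b x y ->
  (forall l, residual x y l = 0) ->
  forall i, spray (golden a b) i x y = golden_proj a b x y * y 0 i.
Proof.
move=> Ux cone h i; have F0 := golden_cone_neq0 Ux cone.
have [y0 _ _] := cone.
rewrite spray_goldenE //.
have -> : 4^-1 *: (\row_l spray_rhs a b x y l)
    = golden_proj a b x y *: (y *m fund_tensor (golden a b) x y).
  rewrite mul_fund_tensor_golden //; apply/rowP => l.
  rewrite mxE [X in _ * X]mxE (spray_rhsE U_open a_riem b_smooth) // h mulr0 addr0.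
  by rewrite [in RHS]mxE [X in _ = _ * X]mxE; field.
by rewrite -scalemxAl mulmxK ?fund_tensor_golden_unit // mxE.
Qed.

(* Both sides of the geodesic equation are contracted with y: the residual is
   orthogonal to y while F_{y^l} y^l = F, which identifies P. *)
Lemma spray_golden_proportional x y P : U x -> golden_cone a b x y ->
  (forall i, spray (golden a b) i x y = P * y 0 i) ->
  forall l, residual x y l = 0.
Proof.
move=> Ux cone h; have F0 := golden_cone_neq0 Ux cone.
have [y0 _ _] := cone.
have al0 : alpha a x y != 0 by rewrite gt_eqF // (alpha_gt0 a_riem).
have e : \row_l spray_rhs a b x y l
    = (4 * P * golden a b x y) *: golden_dy (a x) (b x) y.
  have : 4^-1 *: (\row_l spray_rhs a b x y l)
      *m invmx (fund_tensor (golden a b) x y) = P *: y.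
    by apply/rowP => i; rewrite -spray_goldenE // h [RHS]mxE.
  move/(congr1 (fun v => 4 *: (v *m fund_tensor (golden a b) x y))).
  rewrite mulmxKV ?fund_tensor_golden_unit // scalerA divff ?pnatr_eq0 // scale1r => ->.
  by rewrite -scalemxAl mul_fund_tensor_golden // !scalerA mulrA.
pose kk := 4 * golden a b x y / alpha a x y ^+ 5.
have k0 : kk != 0.
  apply: mulf_neq0; last by rewrite invr_neq0 ?expf_neq0.
  by apply: mulf_neq0 => //; rewrite pnatr_eq0.
have e2 : kk *: (\row_l residual x y l) =
    (4 * (P - golden_proj a b x y) * golden a b x y) *: golden_dy (a x) (b x) y.
  apply/rowP => l; have := congr1 (fun v : 'rV[R]_n => v 0 l) e.
  rewrite mxE [X in _ = X -> _]mxE (spray_rhsE U_open a_riem b_smooth) // -/kk => hh.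
  rewrite [LHS]mxE [X in _ * X = _]mxE [RHS]mxE.
  apply: (addrI (4 * golden_proj a b x y * golden a b x y * golden_dy (a x) (b x) y 0 l)).
  by rewrite hh; ring.
have Pe : P = golden_proj a b x y.
  have := congr1 (dot y) e2; rewrite !dotZr (golden_euler _ (riemannian_pos a_riem Ux) y0).
  rewrite hamel_residual_dot mulr0.
  have -> : Num.sqrt (quad (a x) y) *
      ((dot (b x) y / Num.sqrt (quad (a x) y)) ^+ 2 -
       dot (b x) y / Num.sqrt (quad (a x) y) - 1) = golden a b x y by rewrite goldenE.
  move/esym/eqP; move: (golden a b x y) F0 => F Fn0.
  by rewrite !mulf_eq0 (negPf Fn0) pnatr_eq0 /= !orbF subr_eq0 => /eqP.
move=> l; have := congr1 (fun v : 'rV[R]_n => v 0 l) e2.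
rewrite Pe subrr mulr0 mul0r scale0r mxE [X in _ * X]mxE [X in _ = X -> _]mxE => /eqP.
by rewrite mulf_eq0 (negPf k0) /= => /eqP.
Qed.

Definition cov_mx x : 'M[R]_n := \matrix_(i, j) cov_deriv a b i j x.

Lemma christoffel_sym k i j x : U x -> christoffel a k i j x = christoffel a k j i x.
Proof.
move=> Ux; congr (_ * _); apply: eq_bigr => l _; congr (_ * _).
have -> : partial l (fun x' => a x' i j) x = partial l (fun x' => a x' j i) x.
  apply: near_eq_partial; apply: filterS (near_U U_open Ux) => z Uz.
  by case: a_riem => _ s _; exact: s.
ring.
Qed.

Lemma christoffel_spray k x y : U x ->
  \sum_i \sum_j christoffel a k i j x * y 0 i * y 0 j
  = 2 * (lower_spray a x y *m invmx (a x)) 0 k.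
Proof.
move=> Ux.
pose t l i j : R := (dmetric a i x j l + dmetric a j x i l - dmetric a l x i j) * y 0 i * y 0 j.
have tE l : \sum_i \sum_j t l i j = 4 * lower_spray a x y 0 l.
  have e1 : \sum_i \sum_j dmetric a i x j l * y 0 i * y 0 j
      = \sum_k (y *m dmetric a k x) 0 l * y 0 k.
    apply: eq_bigr => i _; rewrite mxE mulr_suml; apply: eq_bigr => j _; ring.
  have e2 : \sum_i \sum_j dmetric a j x i l * y 0 i * y 0 j
      = \sum_k (y *m dmetric a k x) 0 l * y 0 k.
    rewrite exchange_big; apply: eq_bigr => i _; rewrite mxE mulr_suml.
    by apply: eq_bigr => j _; ring.
  transitivity (\sum_i \sum_j dmetric a i x j l * y 0 i * y 0 j
    + \sum_i \sum_j dmetric a j x i l * y 0 i * y 0 j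
    - \sum_i \sum_j dmetric a l x i j * y 0 i * y 0 j).
    rewrite -big_split -sumrB; apply: eq_bigr => i _ /=.
    by rewrite -big_split -sumrB; apply: eq_bigr => j _ /=; rewrite /t; ring.
  by rewrite e1 e2 -quadE sum_dlower; field.
have isym l : invmx (a x) k l = invmx (a x) l k.
  by rewrite -[in LHS](invmx_sym (riemannian_sym a_riem Ux)) mxE.
transitivity (\sum_l 2^-1 * invmx (a x) k l * \sum_i \sum_j t l i j).
  under [RHS]eq_bigr => l _ do rewrite mulr_sumr.
  rewrite [RHS]exchange_big; apply: eq_bigr => i _.
  under [RHS]eq_bigr => l _ do rewrite mulr_sumr.
  rewrite [RHS]exchange_big; apply: eq_bigr => j _.
  rewrite /christoffel -!mulrA mulr_suml mulr_sumr; apply: eq_bigr => l _.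
  by rewrite /t !mxE; ring.
by rewrite mxE mulr_sumr; apply: eq_bigr => l _; rewrite tE isym; field.
Qed.

Lemma quad_cov x y : U x ->
  quad (cov_mx x) y = r00 (a x) (b x) (dform b x) ((spray_mx a)^~ x) y.
Proof.
move=> Ux; rewrite quadE /r00 -/(lower_spray a x y).
have -> : 2 * dot (b x *m invmx (a x)) (lower_spray a x y) =
    \sum_k b x 0 k * (\sum_i \sum_j christoffel a k i j x * y 0 i * y 0 j).
  rewrite dot_mulmx (invmx_sym (riemannian_sym a_riem Ux)) /dot mulr_sumr.
  by apply: eq_bigr => k _; rewrite christoffel_spray //; ring.
under [X in _ = _ - X]eq_bigr => k _ do rewrite mulr_sumr.
rewrite quadE [X in _ = X - _]exchange_big [X in _ = _ - X]exchange_big -sumrB.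
apply: eq_bigr => i _ /=.
under [X in _ = _ - X]eq_bigr => k _ do rewrite mulr_sumr.
rewrite [X in _ = _ - X]exchange_big -sumrB; apply: eq_bigr => j _ /=.
rewrite !mxE /cov_deriv !mulrBl !mulr_suml; congr (_ - _); first by ring.
by apply: eq_bigr => k _; ring.
Qed.

(** The Levi-Civita connection is torsion free, so the Christoffel terms cancel in the antisymmetric
    part. The sides of the difference are swapped because [dform] has the derivative index first and
    [cov_mx] has it second. *)
Lemma cov_mx_sym x : U x -> ((cov_mx x)^T == cov_mx x) = ((dform b x)^T == dform b x).
Proof.
move=> Ux.
have E : (cov_mx x)^T - cov_mx x = dform b x - (dform b x)^T.
  apply/matrixP => i j; rewrite !mxE /cov_deriv.
  have -> : \sum_k christoffel a k j i x * b x 0 k = \sum_k christoffel a k i j x * b x 0 k.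
    by apply: eq_bigr => k _; rewrite christoffel_sym.
  ring.
by rewrite -subr_eq0 E subr_eq0 eq_sym.
Qed.

End SpraysAndHamel.

(** * Smooth functions *)

(** It is enough to treat g - f, which vanishes near [x] and thus has differential 0 directly from
    the little-o characterization. *)
Lemma near_eq_differentiable (R : numFieldType) (V W : normedModType R)
    (f g : V -> W) (x : V) : (\forall z \near x, f z = g z) ->
  differentiable f x -> differentiable g x.
Proof.
move=> fg df; pose h z := g z - f z.
have -> : g = f + h by apply/funext => z; rewrite /h fctE addrC subrK.
apply: differentiableD => //.
have h0 : \forall z \near x, h z = 0 by apply: filterS fg => z; rewrite /h => ->; rewrite subrr.
have e : h \o shift x = cst (h x) + (0 : V -> W) +o_ 0 id.
  apply/eqaddoP => _/posnumP[eps].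
  have : \forall z \near (0 : V), h (z + x) = 0.
    by rewrite (near_shift 0 x) in h0; apply: filterS h0 => z /=; rewrite subr0.
  apply: filterS => z hz; rewrite !fctE /= hz (nbhs_singleton h0) addr0 subrr normr0.
  by rewrite mulr_ge0.
have dh : 'd h x = 0 :> (V -> W) by apply: diff_unique e; exact: cst_continuous.
by apply/diff_locallyP; rewrite dh; split => //; exact: cst_continuous.
Qed.

Section Smoothness.
Context {R : realType} {n : nat}.
Variable U : set 'rV[R]_n.
Hypothesis U_open : open U.
Implicit Types (f g : 'rV[R]_n -> R).

(* A class stable under products and inverses whose members are smooth; unlike
   smooth_on itself, it is visibly closed under partial derivatives on U. *)
Inductive smooth_closure : ('rV[R]_n -> R) -> Prop :=
| closure_base f of smooth_on U f : smooth_closure f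
| closure_const c : smooth_closure (fun=> c)
| closure_add f g of smooth_closure f & smooth_closure g :
    smooth_closure (fun x => f x + g x)
| closure_mul f g of smooth_closure f & smooth_closure g :
    smooth_closure (fun x => f x * g x)
| closure_inv f of (forall x, U x -> f x != 0) & smooth_closure f :
    smooth_closure (fun x => (f x)^-1).

Lemma smooth_closure_differentiable f x : smooth_closure f -> U x -> differentiable f x.
Proof.
move=> hf Ux; elim: hf => {f}.
- by move=> f /(_ [::] x); apply.
- by move=> c; exact: differentiable_cst.
- by move=> f g _ df _ dg; exact: differentiableD.
- by move=> f g _ df _ dg; exact: differentiableM.
- by move=> f f0 _ df; apply: differentiableV => //; exact: f0.
Qed.

Lemma smooth_partial f k : smooth_on U f -> smooth_on U (partial k f).
Proof.
by move=> hf l x Ux; have := hf (rcons l k) x Ux; rewrite /iter_partial foldr_rcons.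
Qed.

Lemma smooth_closure_is_derive f x k : smooth_closure f -> U x ->
  is_derive x (delta_mx 0 k) f (partial k f x).
Proof. by move=> hf Ux; apply/derivableP/diff_derivable/smooth_closure_differentiable. Qed.

(** The derivative agrees with a member of the class on [U] only; as [U] is open, this is enough to
    differentiate again. *)
Lemma smooth_closure_partial f k : smooth_closure f ->
  exists2 g, smooth_closure g & forall x, U x -> partial k f x = g x.
Proof.
elim=> {f}.
- by move=> f hf; exists (partial k f) => //; apply/closure_base/smooth_partial.
- move=> c; exists (fun=> 0) => [|x _]; first exact: closure_const.
  exact: is_derive_partial (is_derive_const _ _ _).
- move=> f g hf [f' hf' fE] hg [g' hg' gE]; exists (fun x => f' x + g' x).
    exact: closure_add.
  move=> x Ux; rewrite -fE // -gE //.
  exact: is_derive_partial (is_derive_add (smooth_closure_is_derive k hf Ux)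
    (smooth_closure_is_derive k hg Ux)).
- move=> f g hf [f' hf' fE] hg [g' hg' gE]; exists (fun x => f x * g' x + g x * f' x).
    by apply: closure_add; apply: closure_mul.
  move=> x Ux; rewrite -fE // -gE //.
  exact: is_derive_partial (is_derive_mul (smooth_closure_is_derive k hf Ux)
    (smooth_closure_is_derive k hg Ux)).
(* Sign and square are spelled with the constructors of the class, which has neither opposites nor
   powers. *)
- move=> f f0 hf [f' hf' fE]; exists (fun x => (-1 * f' x) * ((f x)^-1 * (f x)^-1)).
    by do ?[exact: closure_const | exact: closure_inv | apply: closure_mul].
  move=> x Ux; rewrite -fE // mulN1r -invfM.
  exact: is_derive_partial (is_derive_inv (f0 x Ux) (smooth_closure_is_derive k hf Ux)).
Qed.

Lemma smooth_closure_smooth f : smooth_closure f -> smooth_on U f.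
Proof.
move=> hf l.
have [g hg fg] : exists2 g, smooth_closure g & forall x, U x -> iter_partial l f x = g x.
  elim: l => [|k l [g hg fg]]; first by exists f.
  have [g' hg' gg'] := smooth_closure_partial k hg; exists g' => // x Ux.
  rewrite -gg' //; apply: near_eq_partial.
  by apply: filterS (open_nbhs_nbhs (conj U_open Ux)) => z; exact: fg.
move=> x Ux; apply: near_eq_differentiable (smooth_closure_differentiable hg Ux).
by apply: filterS (open_nbhs_nbhs (conj U_open Ux)) => z Uz; rewrite fg.
Qed.

Lemma smooth_const (c : R) : smooth_on U (fun=> c).
Proof. exact/smooth_closure_smooth/closure_const. Qed.

Lemma smooth_add f g : smooth_on U f -> smooth_on U g -> smooth_on U (fun x => f x + g x).
Proof. by move=> hf hg; apply/smooth_closure_smooth/closure_add; apply: closure_base. Qed.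

Lemma smooth_mul f g : smooth_on U f -> smooth_on U g -> smooth_on U (fun x => f x * g x).
Proof. by move=> hf hg; apply/smooth_closure_smooth/closure_mul; apply: closure_base. Qed.

Lemma smooth_inv f : (forall x, U x -> f x != 0) -> smooth_on U f ->
  smooth_on U (fun x => (f x)^-1).
Proof. by move=> f0 hf; apply/smooth_closure_smooth/closure_inv => //; apply: closure_base. Qed.

Lemma smooth_opp f : smooth_on U f -> smooth_on U (fun x => - f x).
Proof.
move=> hf; have -> : (fun x => - f x) = (fun x => -1 * f x).
  by apply/funext => x; rewrite mulN1r.
exact: smooth_mul (smooth_const _) hf.
Qed.

Lemma smooth_sub f g : smooth_on U f -> smooth_on U g -> smooth_on U (fun x => f x - g x).
Proof. by move=> hf hg; apply: smooth_add => //; exact: smooth_opp. Qed.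

Lemma smooth_sum (I : Type) (r : seq I) (P : pred I) (f : I -> 'rV[R]_n -> R) :
  (forall i, P i -> smooth_on U (f i)) -> smooth_on U (fun x => \sum_(i <- r | P i) f i x).
Proof.
move=> h; elim: r => [|i r IH].
  by under eq_fun do rewrite big_nil; exact: smooth_const.
under eq_fun do rewrite big_cons.
by case Pi: (P i) => //; apply: smooth_add => //; exact: h.
Qed.

Lemma smooth_prod (I : Type) (r : seq I) (P : pred I) (f : I -> 'rV[R]_n -> R) :
  (forall i, P i -> smooth_on U (f i)) -> smooth_on U (fun x => \prod_(i <- r | P i) f i x).
Proof.
move=> h; elim: r => [|i r IH].
  by under eq_fun do rewrite big_nil; exact: smooth_const.
under eq_fun do rewrite big_cons.
by case Pi: (P i) => //; apply: smooth_mul => //; exact: h.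
Qed.

Lemma smooth_eq_on f g : (forall x, U x -> f x = g x) -> smooth_on U f -> smooth_on U g.
Proof.
move=> fg hf l x Ux.
have e z : U z -> iter_partial l f z = iter_partial l g z.
  elim: l z => [|k l IH] z Uz; first exact: fg.
  apply: near_eq_partial.
  by apply: filterS (open_nbhs_nbhs (conj U_open Uz)) => w; exact: IH.
apply: near_eq_differentiable (hf l x Ux).
by apply: filterS (open_nbhs_nbhs (conj U_open Ux)) => z; exact: e.
Qed.

Lemma smooth_det m (a : 'rV[R]_n -> 'M[R]_m) :
  (forall i j, smooth_on U (fun x => a x i j)) -> smooth_on U (fun x => \det (a x)).
Proof.
move=> h; apply: smooth_sum => s _; apply: smooth_mul; first exact: smooth_const.
by apply: smooth_prod => i _; exact: h.
Qed.

(** Cramer's rule presents the entries as cofactors over a determinant that does not vanish on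
    [U]. *)
Lemma smooth_invmx m (a : 'rV[R]_n -> 'M[R]_m) :
  (forall i j, smooth_on U (fun x => a x i j)) -> (forall x, U x -> a x \in unitmx) ->
  forall i j, smooth_on U (fun x => invmx (a x) i j).
Proof.
move=> h aU i j.
apply: (@smooth_eq_on (fun x => (\det (a x))^-1 * cofactor (a x) j i)).
  by move=> x Ux; rewrite /invmx aU // !mxE.
apply: smooth_mul.
  apply: smooth_inv (smooth_det h) => x Ux.
  by have := aU x Ux; rewrite unitmxE unitfE.
apply: smooth_mul; first exact: smooth_const.
by apply: smooth_det => k l; under eq_fun do rewrite !mxE; exact: h.
Qed.

End Smoothness.

(** * Projective flatness *)

Lemma quad_outer (R : comNzRingType) (n : nat) (b y : 'rV[R]_n) :
  quad (b^T *m b) y = dot b y ^+ 2.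
Proof. by rewrite /quad mul_outer dotZl (dotC y). Qed.

(** Openness is needed only along each line through a cone vector, so a directional derivative
    suffices: it makes the restriction to the line continuous. *)
Lemma is_derive_line_gt0 (R : realType) (n : nat) (f : 'rV[R]_n -> R) (y v : 'rV[R]_n) df :
  is_derive y v f df -> 0 < f y ->
  exists2 e : R, 0 < e & forall t, `|t| < e -> 0 < f (y + t *: v).
Proof.
move=> [d _] f0.
have : {for (0 : R), continuous (fun t : R => f (t *: v + y))}.
  apply/differentiable_continuous/derivable1_diffP.
  exact: (derivable1P f y v).1 d.
rewrite /prop_for /continuous_at scale0r add0r => c.
have [e /= e0 he] := cvgr_gt (f y) c 0 f0.
exists e => // t te; rewrite addrC; apply: he.
by rewrite /= sub0r normrN.
Qed.

Section SmoothTensors.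
Context {R : realType} {n : nat}.
Variable U : set 'rV[R]_n.
Hypothesis U_open : open U.
Implicit Types (u v : 'rV[R]_n -> 'rV[R]_n) (N : 'rV[R]_n -> 'M[R]_n).

Lemma smooth_dot u v : smooth_form U u -> smooth_form U v ->
  smooth_on U (fun x => dot (u x) (v x)).
Proof. by move=> hu hv; apply: smooth_sum => // i _; exact: smooth_mul. Qed.

Lemma smooth_mulmx u N : smooth_form U u -> (forall i j, smooth_on U (fun x => N x i j)) ->
  smooth_form U (fun x => u x *m N x).
Proof.
move=> hu hN i; under eq_fun do rewrite mxE.
by apply: smooth_sum => // j _; exact: smooth_mul.
Qed.

Lemma smooth_quad u N : smooth_form U u -> (forall i j, smooth_on U (fun x => N x i j)) ->
  smooth_on U (fun x => quad (N x) (u x)).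
Proof. by move=> hu hN; apply: smooth_dot => //; exact: smooth_mulmx. Qed.

End SmoothTensors.

Section Golden.
Context {R : realType} {n : nat}.
Variables (U : set 'rV[R]_n) (a : 'rV[R]_n -> 'M[R]_n) (b : 'rV[R]_n -> 'rV[R]_n).
Hypotheses (U_open : open U) (a_riem : riemannian a U) (b_smooth : smooth_form U b).
Implicit Types (x y : 'rV[R]_n) (i j k l : 'I_n).

Let asym := riemannian_sym a_riem.
Let apos := riemannian_pos a_riem.

Lemma golden_cone_line x y v : U x -> golden_cone a b x y ->
  exists2 e : R, 0 < e & forall t, `|t| < e -> golden_cone a b x (y + t *: v).
Proof.
move=> Ux [y0 phi cone]; have A0 := apos Ux y0.
have s0 : Num.sqrt (quad (a x) y) != 0 by rewrite gt_eqF ?sqrtr_gt0.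
have hA := is_derive_quad y v (asym Ux).
have hs := is_derive_mul (is_derive_dot y v (b x))
  (is_derive_inv (f := fun z => Num.sqrt (quad (a x) z)) s0 (is_derive_sqrt A0 hA)).
have c c0 := is_derive_const (c0 : R) y v.
(* The condition y != 0 is preserved in the form alpha^2 > 0. *)
have [e1 e10 h1] := is_derive_line_gt0 hA A0.
have h2' := is_derive_sub (is_derive_sub (is_derive_sqr hs) hs) (c 1).
have [|e2 e20 h2] := is_derive_line_gt0 h2'; first by move: phi; rewrite sratioE.
have h3' := is_derive_sub (is_derive_sub (c (2 * bnorm2 a b x))
  (is_derive_mul (c 3) (is_derive_sqr hs))) (c 1).
have [|e3 e30 h3] := is_derive_line_gt0 h3'; first by move: cone; rewrite sratioE.
exists (Num.min e1 (Num.min e2 e3)); first by rewrite !lt_min e10 e20 e30.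
move=> t; rewrite !lt_min => /and3P[t1 t2 t3]; split.
- by apply/eqP => z; have := h1 t t1; rewrite z quad0 ltxx.
- by rewrite sratioE; exact: h2.
- by rewrite sratioE; exact: h3.
Qed.

(** The last cone inequality times alpha^2 is Q > 0, and discarding 3 s^2 from it leaves 2 b^2 > 1.
    These are the inequalities that the pointwise algebra asks for. *)
Lemma golden_cone_bounds x y : U x -> golden_cone a b x y ->
  [/\ 1 < 2 * dot (b x *m invmx (a x)) (b x), y != 0 &
   0 < (2 * dot (b x *m invmx (a x)) (b x) - 1) * quad (a x) y - 3 * dot (b x) y ^+ 2].
Proof.
move=> Ux [y0 _ cone]; have A0 := apos Ux y0; split=> //.
  by move: cone; rewrite bnorm2E; have := sqr_ge0 (sratio a b x y); lra.
have al0 : alpha a x y != 0 by rewrite gt_eqF // (alpha_gt0 a_riem).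
have -> : dot (b x) y = sratio a b x y * alpha a x y by rewrite divfK.
have -> : (2 * dot (b x *m invmx (a x)) (b x) - 1) * quad (a x) y
    - 3 * (sratio a b x y * alpha a x y) ^+ 2
    = (2 * bnorm2 a b x - 3 * sratio a b x y ^+ 2 - 1) * alpha a x y ^+ 2.
  by rewrite -(sqr_alpha a_riem y Ux) bnorm2E; ring.
by rewrite mulr_gt0 // exprn_gt0 // (alpha_gt0 a_riem).
Qed.

(** * From (i) and (ii) to the spray of F *)

Section Sufficiency.
Variables (tau : 'rV[R]_n -> R) (theta : 'rV[R]_n -> 'rV[R]_n).
Hypothesis cov_tau : forall x i j, U x -> cov_deriv a b i j x =
  tau x * ((2 * bnorm2 a b x - 1) * a x i j - 3 * b x 0 i * b x 0 j).
Hypothesis spray_theta : forall x y i, U x -> y != 0 -> spray (alpha a) i x y =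
  one_form theta x y * y 0 i - tau x * alpha a x y ^+ 2 * b_up a b i x.

Lemma lower_spray_theta x y : U x -> y != 0 -> lower_spray a x y =
  dot (theta x) y *: (y *m a x) - (tau x * quad (a x) y) *: b x.
Proof.
move=> Ux y0; have aU := posdef_unitmx (apos Ux).
have e : lower_spray a x y *m invmx (a x) =
    dot (theta x) y *: y - (tau x * quad (a x) y) *: (b x *m invmx (a x)).
  apply/rowP => i; rewrite -(spray_alphaE U_open a_riem) // spray_theta //.
  rewrite (sqr_alpha a_riem) // (b_upE b a_riem) // [RHS]mxE [X in _ = _ + X]mxE.
  by rewrite [X in _ = X + _]mxE [X in _ = _ - X]mxE.
by rewrite -[LHS](mulmxKV aU) e mulmxBl -!scalemxAl mulmxKV.
Qed.

Lemma r00_cov x y : U x -> r00 (a x) (b x) (dform b x) ((spray_mx a)^~ x) y =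
  tau x * ((2 * bnorm2 a b x - 1) * quad (a x) y - 3 * dot (b x) y ^+ 2).
Proof.
move=> Ux; rewrite -(quad_cov b a_riem) //.
have -> : cov_mx a b x = tau x *: ((2 * bnorm2 a b x - 1) *: a x
    + (- 3) *: ((b x)^T *m b x)).
  by apply/matrixP => i j; rewrite mxE cov_tau // !(outerE, mxE); ring.
by rewrite quad_scalemx quad_addmx !quad_scalemx quad_outer; ring.
Qed.

Lemma dform_sym x : U x -> (dform b x)^T = dform b x.
Proof.
move=> Ux; apply/eqP; rewrite -(cov_mx_sym b U_open a_riem) //; apply/eqP/matrixP => i j.
by rewrite !mxE !cov_tau // (_ : a x j i = a x i j); [ring | rewrite -{1}asym // mxE].
Qed.

Lemma spray_golden_formula x y i : U x -> golden_cone a b x y ->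
  spray (golden a b) i x y =
  (one_form theta x y + tau x * golden_chi a b x y * alpha a x y) * y 0 i.
Proof.
move=> Ux cone; have [y0 phi _] := cone; have A0 := apos Ux y0.
have GE := lower_spray_theta Ux y0; have rE := r00_cov y Ux.
rewrite (spray_golden_residual0 U_open a_riem b_smooth) //; last first.
  move=> l; apply: (hamel_residual_eq0 (asym Ux) (apos Ux) (dform_sym Ux) GE).
  by rewrite rE bnorm2E.
congr (_ * _); rewrite /golden_proj.
have yG : dot y (lower_spray a x y)
    = dot (theta x) y * quad (a x) y - tau x * quad (a x) y * dot (b x) y.
  by rewrite GE !dotE (dotC y (b x)) (dotC y (y *m a x)).
have bG : dot (b x *m invmx (a x)) (lower_spray a x y)
    = dot (theta x) y * dot (b x) y - tau x * quad (a x) y * bnorm2 a b x.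
  by rewrite GE !dotE (dot_bu_lower _ (asym Ux) (apos Ux)) bnorm2E.
have qE : quad (dform b x) y = tau x * ((2 * bnorm2 a b x - 1) * quad (a x) y - 3 * dot (b x) y ^+ 2)
    + 2 * dot (b x *m invmx (a x)) (lower_spray a x y).
  by rewrite -rE /r00 subrK.
have al0 : alpha a x y != 0 by rewrite gt_eqF // (alpha_gt0 a_riem).
have sal : dot (b x) y = sratio a b x y * alpha a x y by rewrite divfK.
(* In the numerator of [golden_proj], b^2 cancels, the theta terms add up to 2 theta F, and the tau
   terms to tau alpha^2 (1 + 3 s^2 - 4 s^3), whose cubic factor is 2 (s^2 - s - 1) chi. *)
rewrite qE bG yG -(sqr_alpha a_riem y Ux) sal /golden /golden_chi /one_form -/(dot (theta x) y).
by field; rewrite al0 /= gt_eqF.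
Qed.

End Sufficiency.

(** * From flatness to tau and theta *)

Section Necessity.
Hypothesis n2 : (2 <= n)%N.
Hypothesis cone_nonempty : forall x, U x -> exists y, golden_cone a b x y.
Variable P : 'rV[R]_n -> 'rV[R]_n -> R.
Hypothesis flat : forall x y i, U x -> golden_cone a b x y ->
  spray (golden a b) i x y = P x y * y 0 i.

Definition flat_tau x : R := hamel_tau (a x) (b x) (dform b x) ((spray_mx a)^~ x).

(** G_alpha + tau alpha^2 b^#, with the index raised after the sum so that the quadratic forms
    remain visible. *)
Definition shifted_spray x y : 'rV[R]_n :=
  (lower_spray a x y + (flat_tau x * quad (a x) y) *: b x) *m invmx (a x).

(** If the shifted spray is theta(y) y, its p-th component at the p-th basis vector must be theta_p;
    this explicit choice is what makes theta smooth. *)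
Definition flat_theta x : 'rV[R]_n := \row_p shifted_spray x (delta_mx 0 p) 0 p.

Lemma bnorm2_gt x : U x -> 1 < 2 * dot (b x *m invmx (a x)) (b x).
Proof. by move=> Ux; have [y /(golden_cone_bounds Ux) []] := cone_nonempty Ux. Qed.

Lemma flat_cov x i j : U x -> cov_deriv a b i j x =
  flat_tau x * ((2 * bnorm2 a b x - 1) * a x i j - 3 * b x 0 i * b x 0 j).
Proof.
move=> Ux; have [y0 y0_cone] := cone_nonempty Ux.
have oD v := golden_cone_line v Ux y0_cone.
have res0 y (cone : golden_cone a b x y) :=
  spray_golden_proportional U_open a_riem b_smooth Ux cone (fun i => flat i Ux cone).
have Msym := curl0 n2 (apos Ux) oD res0.
pose N := flat_tau x *: ((2 * bnorm2 a b x - 1) *: a x + (- 3) *: ((b x)^T *m b x)).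
have -> : cov_deriv a b i j x = cov_mx a b x i j by rewrite mxE.
suff -> : cov_mx a b x = N by rewrite !(outerE, mxE); ring.
apply: sym_quad_inj.
- by apply/eqP; rewrite (cov_mx_sym b U_open a_riem Ux) Msym.
- by rewrite /N !linearZ /= linearD /= !linearZ /= trmx_mul trmxK asym.
move=> y; rewrite (quad_cov b a_riem y Ux).
rewrite (r00_tau n2 (asym Ux) (apos Ux) oD res0 (bnorm2_gt Ux)).
by rewrite /N quad_scalemx quad_addmx !quad_scalemx quad_outer bnorm2E /flat_tau; ring.
Qed.

Lemma flat_shifted_spray x y : U x -> shifted_spray x y = dot (flat_theta x) y *: y.
Proof.
move=> Ux; have [y0 y0_cone] := cone_nonempty Ux.
have oD v := golden_cone_line v Ux y0_cone.
have res0 z (cone : golden_cone a b x z) :=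
  spray_golden_proportional U_open a_riem b_smooth Ux cone (fun i => flat i Ux cone).
have DQ z : golden_cone a b x z -> _ := fun cone =>
  let: And3 _ z0 Q0 := golden_cone_bounds Ux cone in conj z0 Q0.
have aU := posdef_unitmx (apos Ux).
pose N l := spray_mx a l x + (flat_tau x * b x 0 l) *: a x.
have ZE z : shifted_spray x z = (\row_l quad (N l) z) *m invmx (a x).
  congr (_ *m _); apply/rowP => l; rewrite !mxE quad_addmx quad_scalemx; ring.
(* The factor is found by pairing the shifted spray with [z] in the metric and dividing by alpha^2.
   At [z = 0] division by zero returns 0, the value that [quadratic_radial] requires. *)
apply: (quadratic_radial (th := fun z =>
  (dot z (lower_spray a x z) + flat_tau x * quad (a x) z * dot (b x) z) / quad (a x) z)).
- move=> u v; rewrite !ZE !scalemxAl -!mulmxDl; congr (_ *m _).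
  by apply/rowP => l; rewrite !mxE quad_parallelogram.
- move=> c u; rewrite !ZE scalemxAl; congr (_ *m _).
  by apply/rowP => l; rewrite !mxE quadZ.
- by rewrite quad0 invr0 mulr0.
move=> z; have [->|z0] := eqVneq z 0.
  rewrite scaler0 ZE (_ : \row_l _ = 0) ?mul0mx //.
  by apply/rowP => l; rewrite !mxE quad0.
have A0 := apos Ux z0.
rewrite /shifted_spray -[RHS](mulmxK aU) -scalemxAl; congr (_ *m _).
(* Multiplied by alpha^2 and with the index lowered, the claim is a rearrangement of [spray_tau]. *)
apply: (scalerI (lt0r_neq0 A0)); rewrite scalerA mulrCA divff ?gt_eqF // mulr1.
apply/rowP => l.
have := spray_tau n2 (asym Ux) (apos Ux) oD res0 (bnorm2_gt Ux) DQ z l.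
rewrite -/(flat_tau x) -/(lower_spray a x z) => e.
apply/eqP; rewrite -subr_eq0; apply/eqP.
transitivity (quad (a x) z * lower_spray a x z 0 l - dot z (lower_spray a x z) * (z *m a x) 0 l
  - (- flat_tau x * quad (a x) z * (quad (a x) z * b x 0 l - dot (b x) z * (z *m a x) 0 l))).
  move: (z *m a x) (lower_spray a x z) => w G; rewrite !mxE; ring.
by rewrite e subrr.
Qed.

Lemma flat_spray x y i : U x -> spray (alpha a) i x y =
  one_form flat_theta x y * y 0 i - flat_tau x * alpha a x y ^+ 2 * b_up a b i x.
Proof.
move=> Ux; rewrite (spray_alphaE U_open a_riem) // (sqr_alpha a_riem) // (b_upE b a_riem) //.
have := congr1 (fun v : 'rV[R]_n => v 0 i) (flat_shifted_spray y Ux).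
rewrite /shifted_spray mulmxDl -scalemxAl mxE [X in _ + X = _ -> _]mxE.
rewrite [X in _ = X -> _]mxE => /eqP; rewrite eq_sym -subr_eq => /eqP <- //.
Qed.

Let smooth_metric i j : smooth_on U (fun x => a x i j).
Proof. by case: a_riem. Qed.

Let smooth_inv_metric i j : smooth_on U (fun x => invmx (a x) i j).
Proof. exact: smooth_invmx (fun x Ux => posdef_unitmx (apos Ux)) i j. Qed.

Let smooth_dform k l : smooth_on U (fun x => dform b x k l).
Proof. by under eq_fun do rewrite mxE; exact/smooth_partial/b_smooth. Qed.

Let smooth_spray_mx l i j : smooth_on U (fun x => spray_mx a l x i j).
Proof.
under eq_fun do rewrite !mxE.
by apply: smooth_sub => //; apply: smooth_mul => //;
  [exact: smooth_const|exact/smooth_partial|exact: smooth_const|exact/smooth_partial].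
Qed.

Let smooth_lower_spray u : smooth_form U u -> smooth_form U (fun x => lower_spray a x (u x)).
Proof. by move=> hu l; under eq_fun do rewrite mxE; exact: smooth_quad. Qed.

Lemma smooth_flat_tau : smooth_on U flat_tau.
Proof.
have sbu := smooth_mulmx U_open b_smooth smooth_inv_metric.
have sb2 := smooth_dot U_open sbu b_smooth.
apply: smooth_mul => //.
  apply: smooth_opp => //; apply: smooth_sub => //; first exact: smooth_quad.
  apply: smooth_mul => //; first exact: smooth_const.
  by apply: smooth_dot => //; exact: smooth_lower_spray.
apply: smooth_inv => // [x /bnorm2_gt h|].
  by rewrite gt_eqF // mulr_gt0 //; move: h; lra.
by apply: smooth_mul => //; apply: smooth_add => //; exact: smooth_const.
Qed.

Lemma smooth_flat_theta : smooth_form U flat_theta.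
Proof.
move=> p; under eq_fun do rewrite mxE.
have sp : smooth_form U (fun _ : 'rV[R]_n => delta_mx 0 p) by move=> l; exact: smooth_const.
apply: (smooth_mulmx U_open _ smooth_inv_metric p) => l.
under eq_fun do rewrite mxE [X in _ + X]mxE.
apply: smooth_add => //; first exact: smooth_lower_spray sp l.
apply: smooth_mul => //; apply: smooth_mul => //; first exact: smooth_flat_tau.
exact: smooth_quad.
Qed.

End Necessity.
End Golden.

Theorem theorem2p8 (R : realType) (n : nat) (n_ge2 : (2 <= n)%N)
    (U : set 'rV[R]_n) (U_open : open U)
    (a : 'rV[R]_n -> 'M[R]_n) (a_riem : riemannian a U)
    (b : 'rV[R]_n -> 'rV[R]_n) (b_smooth : smooth_form U b)
    (cone_nonempty : forall x : 'rV[R]_n, U x -> exists y : 'rV[R]_n, golden_cone a b x y) :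
  let conditions (tau : 'rV[R]_n -> R) (theta : 'rV[R]_n -> 'rV[R]_n) :=
    [/\ smooth_on U tau,
        smooth_form U theta,
        forall (x : 'rV[R]_n) (i j : 'I_n), U x ->
          cov_deriv a b i j x =
          tau x * ((2 * bnorm2 a b x - 1) * a x i j - 3 * b x 0 i * b x 0 j) &
        forall (x y : 'rV[R]_n) (i : 'I_n), U x -> y != 0 ->
          spray (alpha a) i x y =
          one_form theta x y * y 0 i - tau x * alpha a x y ^+ 2 * b_up a b i x] in
  (projectively_flat U (golden_cone a b) (golden a b) <->
   exists tau theta, conditions tau theta) /\
  (forall tau theta, conditions tau theta ->
   forall (x y : 'rV[R]_n) (i : 'I_n), U x -> golden_cone a b x y ->
     spray (golden a b) i x y =
     (one_form theta x y + tau x * golden_chi a b x y * alpha a x y) * y 0 i).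
Proof.
move=> conditions.
have formula tau theta : conditions tau theta ->
    forall (x y : 'rV[R]_n) (i : 'I_n), U x -> golden_cone a b x y ->
    spray (golden a b) i x y =
    (one_form theta x y + tau x * golden_chi a b x y * alpha a x y) * y 0 i.
  move=> [_ _ cov sp] x y i Ux cone.
  exact: (spray_golden_formula U_open a_riem b_smooth cov sp i Ux cone).
split=> //; split.
  move=> [P [_ flat]]; exists (flat_tau a b), (flat_theta a b); split.
  - exact: (smooth_flat_tau U_open a_riem b_smooth cone_nonempty).
  - exact: (smooth_flat_theta U_open a_riem b_smooth cone_nonempty).
  - by move=> x i j Ux; apply: (flat_cov U_open a_riem b_smooth n_ge2 cone_nonempty flat).
  - by move=> x y i Ux _; apply: (flat_spray U_open a_riem b_smooth n_ge2 cone_nonempty flat).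
move=> [tau [theta cond]].
exists (fun x y => one_form theta x y + tau x * golden_chi a b x y * alpha a x y).
split=> [x y c Ux [y0 _ _] c0|x y i Ux cone]; last exact: formula cond x y i Ux cone.
have alZ : alpha a x (c *: y) = c * alpha a x y.
  by rewrite alphaE quadZ sqrtrM ?sqr_ge0 // sqrtr_sqr gtr0_norm.
have al0 : alpha a x y != 0 by rewrite gt_eqF // (alpha_gt0 a_riem).
have sZ : sratio a b x (c *: y) = sratio a b x y.
  rewrite /sratio alZ /one_form -/(dot (b x) (c *: y)) dotZr -/(dot (b x) y).
  by field; rewrite al0 gt_eqF.
have thZ : one_form theta x (c *: y) = c * one_form theta x y by exact: dotZr.
by rewrite thZ alZ /golden_chi sZ; ring.
Qed.
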